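(* Every linear switching system $\mathcal{A}$ in $\mathbb{R}^d$ has $\sigma(\mathcal{A})$ as an eigenvalue (that is, there exists an eigenset of $\mathcal{A}$ with eigenvalue $\sigma(\mathcal{A})$). Besides $\sigma(\mathcal A)$, the system can have at most $d-1$ other eigenvalues, and all of them are smaller than $\sigma(\mathcal{A})$.
   Context: A linear switching system in $\mathbb{R}^d$ is identified with its control set $\mathcal{A}$, a nonempty compact set of real $d\times d$ matrices. A switching law is a measurable function $A(\cdot):[0,\infty)\to\mathcal{A}$. A trajectory is an absolutely continuous function $x:[0,\infty)\to\mathbb{R}^d$ such that, for some switching law, $\dot x(t)=A(t)x(t)$ for almost every $t$. Standing assumption: $\mathcal{A}$ is convex and does not contain the zero matrix. For a compact set $M\subset\mathbb{R}^d$ and $t\ge 0$, $M_t$ denotes the set of points $x(t)$ over all trajectories with $x(0)\in M$ (if $\mathcal A$ is not convex, the closure of this set). An eigenset of $\mathcal{A}$ is a compact set $M\subset\mathbb{R}^d$, $M\neq\emptyset$, $M\ne\{0\}$, for which there is a constant $\alpha\in\mathbb{R}$ with $M_t=e^{\alpha t}M$ for all $t\ge 0$; $\alpha$ is then called an eigenvalue of $\mathcal{A}$. The Lyapunov exponent $\sigma(\mathcal{A})$ is the infimum of all $\beta\in\mathbb{R}$ such that every trajectory satisfies $\|x(t)\|\le C e^{\beta t}$ for all $t\ge0$ with a constant $C$ depending on the trajectory. *)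

(* Defs.v *)
From HB Require Import structures.
From mathcomp Require Import all_boot all_order all_algebra.
From mathcomp Require Import all_classical all_reals all_analysis.
From mathcomp Require Import measurable_realfun.
Set Implicit Arguments.
Unset Strict Implicit.
Unset Printing Implicit Defensive.
Import Order.TTheory GRing.Theory Num.Theory.
Import numFieldNormedType.Exports.
Local Open Scope classical_set_scope.
Local Open Scope ring_scope.

(* The reals with the sigma-algebra of Lebesgue measurable sets; the library's
   default sigma-algebra on R is the Borel one. *)
Definition lebesgueTypeR (R : realType) :=
  g_sigma_algebraType (completed_algebra_gen (@lebesgue_measure R)).

Definition abs_continuous_on (R : realType) (V : normedModType R) (a b : R)
    (f : R -> V) : Prop :=
  forall e : R, 0 < e -> exists2 r : R, 0 < r &
    forall (n : nat) (u v : 'I_n -> R),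
      (forall i, a <= u i /\ u i <= v i /\ v i <= b) ->
      trivIset [set: 'I_n] (fun i => `]u i, v i[%classic) ->
      \sum_(i < n) (v i - u i) < r ->
      \sum_(i < n) `|f (v i) - f (u i)| < e.

(* Functions on [0, +oo[ are represented by functions on R whose values at
   negative times are irrelevant. *)

(* Measurability of a matrix-valued function is taken entrywise. *)
Definition switching_law (R : realType) (d : nat) (A : set 'M[R]_d)
    (a : R -> 'M[R]_d) : Prop :=
  (forall t : R, 0 <= t -> A (a t)) /\
  (forall i j, measurable_fun (`[0, +oo[%classic : set (lebesgueTypeR R))
                 (fun t => a t i j : measurableTypeR R)).

(* Absolute continuity on the unbounded interval [0, +oo[ is meant on every
   compact subinterval. *)
Definition trajectory (R : realType) (d : nat) (A : set 'M[R]_d)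
    (x : R -> 'cV[R]_d) : Prop :=
  (forall T : R, 0 <= T -> abs_continuous_on 0 T x) /\
  exists2 a : R -> 'M[R]_d, switching_law A a &
    {ae @lebesgue_measure R, forall t : R, 0 <= t ->
      is_derive t (1 : R) x (a t *m x t)}.

(* For a non-convex A one would take the closure of this set instead. *)
Definition reachable_set (R : realType) (d : nat) (A : set 'M[R]_d)
    (M : set 'cV[R]_d) (t : R) : set 'cV[R]_d :=
  [set x t | x in [set x | trajectory A x /\ M (x 0)]].

Definition eigenset (R : realType) (d : nat) (A : set 'M[R]_d)
    (M : set 'cV[R]_d) (alpha : R) : Prop :=
  [/\ compact M, M !=set0, M <> [set 0] &
    forall t : R, 0 <= t ->
      reachable_set A M t = [set expR (alpha * t) *: v | v in M]].

Definition is_eigenvalue (R : realType) (d : nat) (A : set 'M[R]_d)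
    (alpha : R) : Prop :=
  exists M : set 'cV[R]_d, eigenset A M alpha.

(* `|x t| is the sup norm; all norms on R^d give the same set of exponents.
   For a nonempty bounded A and 0 < d this set is nonempty and bounded below,
   so that inf is a genuine infimum. *)
Definition lyapunov_exponent (R : realType) (d : nat) (A : set 'M[R]_d) : R :=
  inf [set beta : R | forall x, trajectory A x ->
    exists C : R, forall t : R, 0 <= t -> `|x t| <= C * expR (beta * t)].

(* Main.v *)
(* A trajectory x is described without integrals by a "law" F, morally the
   primitive of the switching law: (F t - F s) / (t - s) lies in A, and
   x t = x s + (F t - F s) x s up to an error of second order in t - s.  Since
   A is compact and convex, this description passes to pointwise limits, so
   that limits of trajectories along an ultrafilter are trajectories; a
   switching law is recovered by differentiating the Lipschitz function F
   almost everywhere, so no measurable selection is needed.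

   Compactness yields the uniformity of exponential decay: if every trajectory
   issued from an invariant subspace V is o(1), then all of them decay at a
   common exponential rate.  For a real c, the vectors all of whose
   trajectories are O(e^(ct)) form an invariant subspace W_c.  An eigenset for
   alpha lies in W_alpha, and by uniformity it lies in no W_c with c < alpha.
   Hence alpha |-> dim W_alpha is strictly increasing on eigenvalues, with
   values in [1, d], and sigma is an upper bound of the eigenvalues.

   To see that sigma is an eigenvalue, multiply trajectories by e^(-sigma t) so
   as to assume sigma = 0, and take an invariant subspace V of minimal
   dimension that is not exponentially stable.  The norms
   v |-> sup e^(-bt)|x t| over the trajectories x issued from v, once
   normalized, converge as b -> 0 to a nonzero seminorm on V that no trajectory
   increases.  Its kernel is a proper invariant subspace, hence stable, so that
   all trajectories in V are bounded, uniformly.  The vectors of V whose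
   trajectories remain in the unit ball form a forward invariant compact
   neighbourhood of 0 in V, and the set of its points reachable from it at
   arbitrarily late times is the required eigenset. *)

From HB Require Import structures.
Require Import Defs.
From mathcomp Require Import all_boot all_order all_algebra.
From mathcomp Require Import all_classical all_reals all_analysis.
From mathcomp Require Import measurable_realfun ring lra.
Set Implicit Arguments.
Unset Strict Implicit.
Unset Printing Implicit Defensive.
Import Order.TTheory GRing.Theory Num.Theory.
Import numFieldNormedType.Exports.
Local Open Scope classical_set_scope.
Local Open Scope card_scope.
Local Open Scope ring_scope.

(** * Limits along ultrafilters *)

Section ultralimits.
Context {T : Type} {U : set_system T} {UU : UltraFilter U}.

Lemma ultra_fmap (S : Type) (u : T -> S) : UltraFilter (u @ U).
Proof.
split; first exact: fmap_proper_filter.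
move=> G GF uG; apply/seteqP; split=> [B GB|]; last exact: uG.
have [//|nB] := in_ultra_setVsetC (u @^-1` B) UU.
have /filter_ex [x []] // : G (B `&` ~` B) by apply: filterI => //; exact: uG.
Qed.

Lemma compact_ultra_cvg (S : topologicalType) (A : set S) (u : T -> S) :
  compact A -> (\forall k \near U, A (u k)) -> exists2 l, A l & u @ U --> l.
Proof.
rewrite compact_ultra => /(_ (u @ U) (ultra_fmap u)) cA /cA [l [Al ul]].
by exists l.
Qed.

End ultralimits.

(** One ultrafilter finer than [\oo] serves for all limits of sequences: bounded sequences of
    vectors converge along it, at all times simultaneously, without extraction of subsequences. *)
Lemma eventually_ultra : exists2 U : set_system nat, UltraFilter U & \oo `<=` U.
Proof. by have [G [? ?]] := ultraFilterLemma eventually_filter; exists G. Qed.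

(** * Norms and limits of matrices *)

Section mx_norm_lemmas.
Context {R : realType}.

Lemma mx_norm_le m n (M : 'M[R]_(m, n)) (c : R) :
  0 <= c -> (forall i j, `|M i j| <= c) -> `|M| <= c.
Proof.
move=> c0 Mc; rewrite [leLHS]/Num.norm/= mx_normrE; apply/bigmax_leP.
by split => // -[i j] _; exact: Mc.
Qed.

Lemma mx_norm_coord m n (M : 'M[R]_(m, n)) i j : `|M i j| <= `|M|.
Proof.
rewrite [leRHS]/Num.norm/= mx_normrE.
exact: (le_bigmax _ (fun ij => `|M ij.1 ij.2|) (i, j)).
Qed.

Lemma mx_normM m n p (M : 'M[R]_(m, n)) (N : 'M[R]_(n, p)) :
  `|M *m N| <= n%:R * `|M| * `|N|.
Proof.
apply: mx_norm_le => [|i j]; first by rewrite !mulr_ge0.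
rewrite mxE (le_trans (ler_norm_sum _ _ _))//.
rewrite (@le_trans _ _ (\sum_(k < n) `|M| * `|N|))//.
  by apply: ler_sum => k _; rewrite normrM ler_pM// mx_norm_coord.
by rewrite sumr_const card_ord -mulrA mulr_natl.
Qed.

Section cvg_mx.
Context {T : Type} {F : set_system T} {FF : Filter F}.

Lemma cvg_mx_coord m n (u : T -> 'M[R]_(m, n)) (l : 'M[R]_(m, n)) :
  (forall i j, u k i j @[k --> F] --> (l i j : R)) -> u @ F --> l.
Proof.
move=> ul; apply/cvgrPdist_lt => e e0.
have : \forall k \near F, forall ij, `|l ij.1 ij.2 - u k ij.1 ij.2| < e.
  by apply: filter_forall => -[i j]; have /cvgrPdist_lt/(_ _ e0) := ul i j.
apply: filterS => k ke.
rewrite [ltLHS]/Num.norm/= mx_normrE; apply/bigmax_ltP; split => // -[i j] _.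
by rewrite !mxE; exact: (ke (i, j)).
Qed.

Lemma cvg_mulmx m n p (u : T -> 'M[R]_(m, n)) (v : T -> 'M[R]_(n, p))
    (a : 'M[R]_(m, n)) (b : 'M[R]_(n, p)) :
  u @ F --> a -> v @ F --> b -> u k *m v k @[k --> F] --> a *m b.
Proof.
move=> ua vb; apply: cvg_mx_coord => i j.
rewrite mxE; under eq_cvg do rewrite mxE.
apply: (@cvg_big R^o 'I_n +%R 0 xpredT (@add_continuous R^o) _ F
  (index_enum 'I_n) (fun k x => u x i k * v x k j) (fun k => a i k * b k j)).
by move=> k _; apply: cvgM; apply: (continuous_cvg _ (@coord_continuous _ _ _ _ _ _)).
Qed.
End cvg_mx.

Lemma mx_ultra_cvg T (U : set_system T) {UU : UltraFilter U} m n
    (u : T -> 'M[R]_(m, n)) (c : R) : (\forall k \near U, `|u k| <= c) ->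
  exists l : 'M[R]_(m, n), u @ U --> l.
Proof.
move=> uc.
have h (ij : 'I_m * 'I_n) : {l | u k ij.1 ij.2 @[k --> U] --> (l : R)}.
  apply: cid; have [|l _] := @compact_ultra_cvg _ _ UU R `[- c, c]%classic
    (fun k => u k ij.1 ij.2) (@segment_compact _ _ _); last by exists l.
  apply: filterS uc => k uk /=; rewrite in_itv/= -ler_norml.
  by rewrite (le_trans (mx_norm_coord _ _ _)).
exists (\matrix_(i, j) sval (h (i, j))); apply: cvg_mx_coord => i j.
by rewrite mxE; exact: svalP (h (i, j)).
Qed.

End mx_norm_lemmas.

(** * Almost everywhere differentiability of Lipschitz functions *)

Section lipschitz_derivable.
Context {R : realType}.
Notation mu := (@lebesgue_measure R).

Lemma lipschitz_continuous (V W : normedModType R) (f : V -> W) (C : R) :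
  (forall x y, `|f x - f y| <= C * `|x - y|) -> continuous f.
Proof.
move=> fC x; apply/cvgrPdist_lt => e e0.
have C0 : 0 < `|C| + 1 by rewrite ltr_wpDl.
near=> y; rewrite (le_lt_trans (fC x y))//.
have : `|x - y| < e / (`|C| + 1).
  by near: y; apply: cvgr_dist_lt => //; rewrite divr_gt0.
rewrite ltr_pdivlMr// mulrC => xye; rewrite (le_lt_trans _ xye)//.
by rewrite ler_wpM2r// (le_trans (ler_norm _))// lerDl.
Unshelve. all: by end_near. Qed.

Lemma lebesgue_stieltjes_ocitv (f : cumulative R R) (a b : R) : a <= b ->
  lebesgue_stieltjes_measure f `]a, b]%classic = (f b - f a)%:E.
Proof.
move=> ab; rewrite /lebesgue_stieltjes_measure.
rewrite /measure_extension measurable_mu_extE/=; last exact: is_ocitv.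
by rewrite wlength_itv_bnd.
Qed.

Variables (g : R -> R) (C : R).
Hypothesis g_nd : nondecreasing g.
Hypothesis gC : forall x y, x <= y -> g y - g x <= C * (y - x).

Let C0 : 0 <= C.
Proof.
have := gC (@ler01 R); rewrite subr0 mulr1; apply: le_trans.
by rewrite subr_ge0 g_nd.
Qed.

Let gl x y : `|g x - g y| <= C * `|x - y|.
Proof.
wlog : x y / y <= x.
  by move=> h; have [/h//|/ltW/h] := leP y x; rewrite distrC [in leRHS]distrC.
by move=> yx; rewrite !ger0_norm ?subr_ge0 ?g_nd// gC.
Qed.

Let k x := C * x - g x.

Let k_nd : nondecreasing k.
Proof. by move=> x y xy; have := gC xy; rewrite /k; lra. Qed.

Let kl x y : `|k x - k y| <= (C + C) * `|x - y|.
Proof.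
have -> : k x - k y = C * (x - y) - (g x - g y) by rewrite /k; ring.
rewrite (le_trans (ler_normB _ _))// mulrDl lerD// normrM ger0_norm//.
Qed.

Let cg : cumulative R R := HB.pack g (isCumulative.Build R _ R g g_nd
  (right_continuousW (lipschitz_continuous gl))).
Let ck : cumulative R R := HB.pack k (isCumulative.Build R _ R k k_nd
  (right_continuousW (lipschitz_continuous kl))).

Let lsg : {measure set (measurableTypeR R) -> \bar R} :=
  lebesgue_stieltjes_measure cg.

Let mulC_nd : nondecreasing ( *%R C).
Proof. by move=> x y; apply: ler_wpM2l. Qed.

Let mulC_rc : right_continuous ( *%R C).
Proof.
apply: right_continuousW; apply: (@lipschitz_continuous R^o R^o _ C) => x y.
by rewrite -mulrBr normrM ger0_norm.
Qed.

Let cC : cumulative R R :=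
  HB.pack ( *%R C) (isCumulative.Build R _ R _ mulC_nd mulC_rc).

(* The Stieltjes measures of g and of C * x - g x add up to C * mu. *)
Let lsgC : lsg `<< mu.
Proof.
pose msum : {measure set (measurableTypeR R) -> \bar R} :=
  measure_add (lebesgue_stieltjes_measure cg) (lebesgue_stieltjes_measure ck).
pose msc : {measure set (measurableTypeR R) -> \bar R} := mscale (NngNum C0) mu.
apply/null_content_dominatesP => A mA A0.
have E1 X : ocitv X -> lebesgue_stieltjes_measure cC X = msc X.
  move=> /ocitvP[->|[[a b] /= ab ->]]; first by rewrite !measure0.
  rewrite lebesgue_stieltjes_ocitv ?ltW//= /mscale/= lebesgue_measure_itv/=.
  by rewrite lte_fin ab -EFinB -EFinM mulrBr.
have E2 X : ocitv X -> lebesgue_stieltjes_measure cC X = msum X.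
  move=> /ocitvP[->|[[a b] /= ab ->]]; first by rewrite !measure0.
  rewrite lebesgue_stieltjes_ocitv ?ltW// [RHS]measure_addE/=.
  rewrite !lebesgue_stieltjes_ocitv ?ltW//= -EFinD; congr (_%:E).
  by rewrite /k; ring.
have := lebesgue_stieltjes_measure_unique E2 mA.
rewrite (lebesgue_stieltjes_measure_unique E1 mA)/= /mscale A0 mule0.
move=> /esym/eqP; rewrite [X in X == _]measure_addE.
by rewrite padde_eq0// => /andP[/eqP].
Qed.

(** By [lsgC] the Stieltjes measure of g has a Lebesgue density, whose integral over []-N, y]] is g
    up to a constant, so that Lebesgue differentiation applies. Truncating to a bounded interval
    makes the measure finite and the density integrable. *)
Let derivable_on (N : nat) :
  {ae mu, forall x, - N%:R < x < N%:R -> derivable g x 1}.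
Proof.
have mD : measurable (`]- N%:R, N%:R]%classic : set (measurableTypeR R)).
  exact: measurable_itv.
have NN : - N%:R <= N%:R :> R by rewrite ge0_cp.
have Doo : (lsg `](- N%:R)%R, N%:R%R]%classic < +oo)%E.
  by rewrite [X in (X < _)%E]lebesgue_stieltjes_ocitv// ltry.
pose nu : {finite_measure set (measurableTypeR R) -> \bar R} := mfrestr mD Doo.
have numu : nu `<< mu.
  apply/null_content_dominatesP => A mA A0.
  have /null_content_dominatesP h := lsgC.
  apply/eqP; rewrite eq_le measure_ge0 andbT /nu/= /mfrestr /mrestr.
  by rewrite -(h A mA A0) le_measure// inE//; exact: measurableI.
have [h [h0 hfin hint hE]] := radon_nikodym_sigma_finite numu.
pose f := fine \o h.
have hf : h = EFin \o f by apply/funext => x; rewrite /f/= fineK.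
have fint A : measurable A -> mu.-integrable A (EFin \o f).
  by move=> mA; rewrite -hf; exact: integrableS hint.
have := @FTC1Ny R f (fun y => fint _ (measurable_itv _))
  (open_integrable_locally openT (fint _ measurableT)).
apply: (filterS (Filter := ae_filter_ringOfSetsType _)) => x /= [dF _] /andP[Nx xN].
have FE y : - N%:R <= y <= N%:R ->
    (\int[mu]_(t in `]-oo, y]) f t)%R = g y - g (- N%:R).
  move=> /andP[Ny yN]; rewrite /Rintegral.
  have -> : (\int[mu]_(t in `]-oo, y]) (f t)%:E)%E = nu `]-oo, y]%classic.
    rewrite hE; last exact: measurable_itv.
    by apply: eq_integral => t _; rewrite /f/= fineK.
  rewrite /nu/= /mfrestr /mrestr.
  rewrite (_ : _ `&` _ = `]- N%:R, y]%classic).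
    by rewrite [X in fine X]lebesgue_stieltjes_ocitv.
  apply/seteqP; split => t /=; rewrite !in_itv/=.
    by move=> [-> /andP[->]].
  by move=> /andP[-> ty]; split => //; rewrite (le_trans ty).
move/cvg_ex : dF => [l dF]; apply/cvg_ex; exists l.
apply: cvg_trans dF; apply: near_eq_cvg; near=> e.
rewrite /= !FE ?(ltW Nx) ?(ltW xN)//; first by congr (_ *: _); ring.
have e1 : `|e| < N%:R - x by near: e; apply: dnbhs0_lt; rewrite subr_gt0.
have e2 : `|e| < x + N%:R by near: e; apply: dnbhs0_lt; rewrite -ltrBlDr sub0r.
move: e1 e2; rewrite /GRing.scale/= mulr1 !ltr_norml; lra.
Unshelve. all: by end_near. Qed.

Lemma nondecreasing_lipschitz_derivable : {ae mu, forall x, derivable g x 1}.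
Proof.
have := ae_foralln derivable_on; apply: (filterS (Filter := ae_filter_ringOfSetsType _)) => x dx.
apply: (dx (Num.bound `|x|)).
by rewrite -ltr_norml archi_boundP.
Qed.

End lipschitz_derivable.

(** Adding [C * x] makes f nondecreasing and keeps it Lipschitz, with constant [C + C]. *)
Lemma lipschitz_ae_derivable (R : realType) (f : R -> R) (C : R) :
  (forall x y, x <= y -> `|f y - f x| <= C * (y - x)) ->
  {ae @lebesgue_measure R, forall x, derivable f x 1}.
Proof.
move=> fC.
have h1 : nondecreasing (fun x => f x + C * x).
  by move=> x y xy; have := fC _ _ xy; rewrite ler_norml => /andP[]; lra.
have h2 x y : x <= y ->
    (f y + C * y) - (f x + C * x) <= (C + C) * (y - x).
  by move=> xy; have := fC _ _ xy; rewrite ler_norml => /andP[]; lra.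
have := nondecreasing_lipschitz_derivable h1 h2; apply: (filterS (Filter := ae_filter_ringOfSetsType _)) => x dx.
have -> : f = (fun x => f x + C * x) - (fun x => C * x).
  by apply/funext => y; rewrite !fctE addrK.
by apply: derivableB => //; exact: derivableM.
Qed.

(** * A mean value theorem for absolutely continuous functions *)

Lemma subrACA (V : zmodType) (a b x y : V) : a - b - (x - y) = a - x - (b - y).
Proof. by rewrite opprD opprK addrACA [in RHS]opprD opprK. Qed.

Lemma is_derive_approx (R : realType) (W : normedModType R) (f : R -> W)
    (t : R) (w : W) (e : R) : is_derive t 1 f w -> 0 < e ->
  exists2 r, 0 < r &
    forall h, `|h| < r -> `|f (t + h) - f t - h *: w| <= e * `|h|.
Proof.
move=> [df <-] e0.
have /cvgrPdist_lt/(_ _ e0) : h^-1 *: (f (h *: 1 + t) - f t) @[h --> 0^'] --> 'D_1 f t.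
  exact: df.
move=> /nbhs_ballP[r /= r0 hr]; exists r => // h hr1.
have [->|h0] := eqVneq h 0.
  by rewrite addr0 subrr scale0r subr0 !normr0 mulr0.
have := hr h; rewrite /ball/= sub0r normrN => /(_ hr1 h0) /ltW.
rewrite -(ler_pM2l (_ : 0 < `|h|)) ?normr_gt0// -normrZ scalerBr scalerA.
rewrite mulfV// scale1r distrC [h *: 1]mulr1 (addrC t) mulrC.
by [].
Qed.

Section ae_mean_value.
Context {R : realType} {W : normedModType R}.
Notation mu := (@lebesgue_measure R).
Variables (f : R -> W) (a b : R) (D : set W).
Hypothesis ab : a <= b.
Hypotheses (Dconv : forall p q l, D p -> D q -> 0 <= l <= 1 ->
  D (l *: p + (1 - l) *: q)).
Variables (p0 : W) (Dp0 : D p0) (O : set R).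

Let comb c v p q : D p -> D q -> a <= c -> c <= v ->
  exists2 r, D r & (v - a) *: r = (c - a) *: p + (v - c) *: q.
Proof.
move=> Dp Dq ac cv; have [va|av] := leP v a.
  exists p => //; have -> : v = a by lra.
  have -> : c = a by lra.
  by rewrite subrr !scale0r addr0.
have va : v - a != 0 by lra.
exists (((c - a) / (v - a)) *: p + (1 - (c - a) / (v - a)) *: q).
  apply: Dconv => //; rewrite divr_ge0 ?subr_ge0//=; last lra.
  by rewrite ler_pdivrMr ?subr_gt0// mul1r lerB.
rewrite scalerDr !scalerA; congr (_ *: _ + _ *: _); field => //.
Qed.

(* The intervals of s are listed from right to left. *)
Fixpoint ordered_within (c : R) (s : seq (R * R)) : Prop :=
  if s is (u, v) :: s' then
    [/\ a <= u, u <= v, v <= c, `[u, v]%classic `<=` O & ordered_within u s']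
  else a <= c.

Let ordered_within_widen c d s : c <= d -> ordered_within c s -> ordered_within d s.
Proof.
case: s => [|[u v] s] cd /=; first by move=> /le_trans; apply.
by move=> [? ? vc ? ?]; split => //; exact: le_trans cd.
Qed.

Let ordered_within_nth c s i : ordered_within c s -> (i < size s)%N ->
  let p := nth (a, a) s i in [/\ a <= p.1, p.1 <= p.2 & p.2 <= c].
Proof.
elim: s c i => [|[u v] s ih] c [|i] //= [au uv vc uvO su]; first by [].
rewrite ltnS => /(ih u i su) /= [h1 h2 h3]; split => //.
exact: (le_trans h3 (le_trans uv vc)).
Qed.

Let ordered_within_lt c s i j : ordered_within c s -> (i < j < size s)%N ->
  (nth (a, a) s j).2 <= (nth (a, a) s i).1.
Proof.
elim: s c i j => [|[u v] s ih] c i [|j] //=; rewrite ?ltn0 ?andbF//.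
move=> [au uv vc uvO su]; case: i => [|i] /=.
  by rewrite ltnS => /(ordered_within_nth su)[].
by rewrite !ltnS => /(ih u) ->.
Qed.

(** The half-open intervals []u, v]] are pairwise disjoint parts of O, so their measures add up
    inside that of O. *)
Let ordered_within_measure c s : measurable O -> ordered_within c s ->
  ((\sum_(p <- s) (p.2 - p.1))%:E <= mu (O `&` `]a, c]))%E.
Proof.
move=> mO; elim: s c => [|[u v] s ih] c /=.
  by move=> _; rewrite big_nil measure_ge0.
move=> [au uv vc uvO su]; rewrite big_cons/= addrC.
rewrite (@le_trans _ _ (mu ((O `&` `]a, u]) `|` `]u, v])))//.
  rewrite measureU//; last 2 first.
  - exact: measurableI.
  - apply/seteqP; split => x //=; rewrite !in_itv/=; lra.
  rewrite EFinD leeD ?ih//.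
  rewrite [X in (_ <= X)%E](lebesgue_measure_itv `]u, v])/= lte_fin.
  by case: ltP => //; rewrite lee_fin subr_le0.
apply: le_measure; rewrite ?inE; first by apply: measurableU => //; exact: measurableI.
  exact: measurableI.
move=> x /= [[Ox]|]; rewrite !in_itv/= => /andP[h1 h2]; split => //.
- by rewrite h1 (le_trans h2)// (le_trans uv).
- by apply: uvO; rewrite /= in_itv/= h2 ltW.
- by rewrite (le_lt_trans au)//= (le_trans h2).
Qed.

Lemma ordered_within_sum (e r : R) s : measurable O -> (mu O < r%:E)%E ->
  (forall (n : nat) (u v : 'I_n -> R),
      (forall i, a <= u i /\ u i <= v i /\ v i <= b) ->
      trivIset [set: 'I_n] (fun i => `]u i, v i[%classic) ->
      \sum_(i < n) (v i - u i) < r ->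
      \sum_(i < n) `|f (v i) - f (u i)| < e) ->
  ordered_within b s ->
  \sum_(p <- s) (p.2 - p.1) < r /\ \sum_(p <- s) `|f p.2 - f p.1| < e.
Proof.
move=> mO Or fe sb.
have lr : \sum_(p <- s) (p.2 - p.1) < r.
  rewrite -lte_fin (le_lt_trans (ordered_within_measure mO sb))//.
  rewrite (le_lt_trans _ Or)// le_measure ?inE//; exact: measurableI.
split=> //; move: lr; rewrite !(big_nth (a, a)) !big_mkord; apply: fe => [i|].
  by have [? ?] := ordered_within_nth sb (ltn_ord i).
move=> i j _ _ [x [/=]]; rewrite !in_itv/= => /andP[h1 h2] /andP[h3 h4].
apply/val_inj; case: (ltngtP i j) => // ij.
- have := ordered_within_lt (i := i) (j := j) sb; rewrite ij ltn_ord => /(_ isT) ji.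
  by have := lt_trans h1 (lt_le_trans h4 ji); rewrite ltxx.
- have := ordered_within_lt (i := j) (j := i) sb; rewrite ij ltn_ord => /(_ isT) ji.
  by have := lt_trans h3 (lt_le_trans h2 ji); rewrite ltxx.
Qed.

(* The interval [a, c] is cut into intervals where the increment of f is
   approximated by D, and intervals s contained in O, whose contribution is
   controlled by absolute continuity when O has small measure. *)
Let P (K' c : R) := exists s, ordered_within c s /\ exists2 p, D p &
  `|f c - f a - (c - a) *: p| <= K' * (c - a) +
    \sum_(q <- s) (`|f q.2 - f q.1| + (q.2 - q.1) * `|p0|).

Let P_within K' c : P K' c -> a <= c.
Proof.
case=> -[|[u v] s] [//= [? ? ? ? ?]] _; lra.
Qed.

(** The mean slope over [[a, v]] is the average of p and q weighted by lengths, which stays in D by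
    convexity; the errors over [[a, c]] and [[c, v]] simply add. *)
Let P_step K' c v q E : D q -> P K' c -> c <= v -> 
  `|f v - f c - (v - c) *: q| <= K' * (v - c) + E ->
  exists s, ordered_within c s /\ exists2 p, D p &
  `|f v - f a - (v - a) *: p| <= K' * (v - a) + E +
    \sum_(q <- s) (`|f q.2 - f q.1| + (q.2 - q.1) * `|p0|).
Proof.
move=> Dq Pc cv fq; have ac := P_within Pc.
move: Pc => [s [cs [p Dp fp]]]; exists s; split=> //.
have [r Dr rE] := comb Dp Dq ac cv; exists r => //; rewrite rE.
have -> : f v - f a - ((c - a) *: p + (v - c) *: q) =
  (f v - f c - (v - c) *: q) + (f c - f a - (c - a) *: p).
  rewrite opprD [RHS]addrACA; congr (_ + _); last by rewrite addrC.
  by rewrite addrA subrK.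
by rewrite (le_trans (ler_normD _ _))//; lra.
Qed.

Let P_good K' c v q : D q -> P K' c -> c <= v ->
  `|f v - f c - (v - c) *: q| <= K' * (v - c) -> P K' v.
Proof.
move=> Dq Pc cv; rewrite -[leRHS]addr0 => /(P_step Dq Pc cv)[s [cs [p Dp]]].
rewrite addr0 => fp; exists s; split; first exact: ordered_within_widen cs.
by exists p.
Qed.

(** Inside O no slope is available: p0 is used by default and the whole increment is charged to the
    list s. *)
Let P_bad K' c v : 0 <= K' -> P K' c -> c <= v -> `[c, v]%classic `<=` O ->
  P K' v.
Proof.
move=> K'0 Pc cv cvO; have ac := P_within Pc.
have : `|f v - f c - (v - c) *: p0| <=
    K' * (v - c) + (`|f v - f c| + (v - c) * `|p0|).
  rewrite (le_trans (ler_normB _ _))// normrZ ger0_norm ?subr_ge0// lerDr.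
  by rewrite mulr_ge0 ?subr_ge0.
move=> /(P_step Dp0 Pc cv)[s [cs [p Dp fp]]].
exists ((c, v) :: s); split => //=.
by exists p => //; rewrite big_cons/= addrA.
Qed.

(** Induction along the real interval: around the supremum t of the points that satisfy P, one step
    leads from some u on its left to points on its right, so t can only be b. *)
Let P_end K' : 0 <= K' ->
  (forall t, a <= t <= b -> ~ O t -> exists2 r, 0 < r &
    exists2 q, D q & forall u v, t - r < u -> u <= t -> t <= v -> v < t + r ->
      `|f v - f u - (v - u) *: q| <= K' * (v - u)) ->
  open O -> P K' b.
Proof.
move=> K'0 good oO.
pose S := [set c | c <= b /\ P K' c].
have Sa : S a.
  split => //; exists [::]; split => //=; exists p0 => //.
  by rewrite !subrr scale0r subr0 normr0 mulr0 add0r big_nil.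
have Sb : ubound S b by move=> c [].
have supS : has_sup S by split; [exists a|exists b].
set t := sup S.
have ta : a <= t by apply: ub_le_sup => //; exists b.
have tb : t <= b by apply: ge_sup => //; exists a.
have [r r0 step] : exists2 r, 0 < r & forall u v,
    t - r < u -> u <= t -> t <= v -> v < t + r -> P K' u -> P K' v.
  have [Ot|Ot] := pselect (O t).
    have /nbhs_ballP[r /= r0 rO] : nbhs t O by exact: open_nbhs_nbhs.
    exists r => // u v u1 u2 v1 v2 Pu; apply: (P_bad K'0 Pu); first lra.
    move=> x /=; rewrite in_itv/= => /andP[ux xv]; apply: rO.
    by rewrite /ball/= ltr_norml; lra.
  have [r r0 [q Dq h]] := good t (introT andP (conj ta tb)) Ot.
  exists r => // u v u1 u2 v1 v2 Pu; apply: (P_good Dq Pu); first lra.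
  exact: h.
have [u [ub Pu] tu] := sup_adherent r0 supS.
have ut : u <= t by apply: ub_le_sup => //; exists b.
have [tb1|bt] := ltP t b.
  have Pv : P K' (Num.min b (t + r / 2)).
    have : Num.min b (t + r / 2) <= t + r / 2 by rewrite ge_min lexx orbT.
    have : t <= Num.min b (t + r / 2) by rewrite le_min; lra.
    by move=> ? ?; apply: (step u) => //; lra.
  have : Num.min b (t + r / 2) <= t.
    by apply: ub_le_sup; [exists b|split => //; rewrite ge_min lexx].
  by rewrite ge_min; lra.
have -> : b = t by lra.
by apply: (step u) => //; lra.
Qed.

Lemma ae_mean_value_cover (K' e r : R) : 0 <= K' ->
  (forall t, a <= t <= b -> ~ O t -> exists2 r, 0 < r &
    exists2 q, D q & forall u v, t - r < u -> u <= t -> t <= v -> v < t + r ->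
      `|f v - f u - (v - u) *: q| <= K' * (v - u)) ->
  open O -> (mu O < r%:E)%E ->
  (forall (n : nat) (u v : 'I_n -> R),
      (forall i, a <= u i /\ u i <= v i /\ v i <= b) ->
      trivIset [set: 'I_n] (fun i => `]u i, v i[%classic) ->
      \sum_(i < n) (v i - u i) < r ->
      \sum_(i < n) `|f (v i) - f (u i)| < e) ->
  exists2 p, D p &
    `|f b - f a - (b - a) *: p| <= K' * (b - a) + e + r * `|p0|.
Proof.
move=> K'0 good oO Or fe.
have [s [sb [p Dp fp]]] := P_end K'0 good oO.
exists p => //; rewrite (le_trans fp)// -addrA lerD2l big_split/=.
have [lr fle] := ordered_within_sum (open_measurable oO) Or fe sb.
by rewrite -mulr_suml lerD ?(ltW fle)// ler_wpM2r// ltW.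
Qed.

End ae_mean_value.

(** The exceptional null set is enclosed in an open set U of small measure. Outside U, derivatives
    give local slopes within [K + e1] of D; inside U, absolute continuity bounds the increments. *)
Lemma ae_mean_value (R : realType) (W : normedModType R) (f : R -> W)
    (a b K : R) (D : set W) :
  a <= b -> 0 <= K -> abs_continuous_on a b f ->
  (forall p q l, D p -> D q -> 0 <= l <= 1 -> D (l *: p + (1 - l) *: q)) ->
  D !=set0 ->
  {ae @lebesgue_measure R, forall t, a <= t <= b ->
    exists2 p, D p & exists2 w, is_derive t (1 : R) f w & `|w - p| <= K} ->
  forall e, 0 < e -> exists2 p, D p &
    `|f b - f a - (b - a) *: p| <= K * (b - a) + e.
Proof.
move=> ab K0 fac Dconv [p0 Dp0] [Z [mZ Z0 hZ]] e e0.
(* The error e is shared equally between the differentiability error [e1 * (b - a)], the increments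
   of f over U, and the default slope p0 over a length at most d. *)
pose e1 := e / 3 / (b - a + 1).
have ba1 : 0 < b - a + 1 by rewrite ltr_wpDl ?subr_ge0.
have e10 : 0 < e1 by rewrite !divr_gt0.
have [r r0 fr] := fac (e / 3) ltac:(lra).
have p01 : 0 < `|p0| + 1 by rewrite ltr_wpDl.
pose d := Num.min r (e / 3 / (`|p0| + 1)).
have d0 : 0 < d by rewrite lt_min r0 !divr_gt0.
have Zoo : (lebesgue_measure Z < +oo)%E by rewrite Z0 ltry.
have [U [openU ZU Ud]] := lebesgue_regularity_outer mZ Zoo d0.
have mU : (lebesgue_measure U < d%:E)%E.
  rewrite (le_lt_trans _ Ud)//.
  rewrite -[X in (lebesgue_measure X <= _)%E](setDUK ZU).
  have mUZ : measurable (U `\` Z)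
    by apply: measurableD; [exact: open_measurable|exact: mZ].
  apply: (le_trans (measureU2 _ mZ mUZ)).
  by rewrite [X in (X + _)%E]Z0 add0e.
have K'0 : 0 <= K + e1 by rewrite addr_ge0// ltW.
have good t : a <= t <= b -> ~ U t -> exists2 r, 0 < r &
    exists2 q, D q & forall u v, t - r < u -> u <= t -> t <= v -> v < t + r ->
      `|f v - f u - (v - u) *: q| <= (K + e1) * (v - u).
  move=> tab Ut.
  have : ~ Z t by move=> /ZU.
  move=> /(contra_not (@hZ t))/contrapT /(_ tab)[p Dp [w dw wp]].
  have [r1 r10 hr] := is_derive_approx dw e10.
  exists r1 => //; exists p => // u v u1 u2 v1 v2.
  have := hr (v - t) ltac:(rewrite ltr_norml; lra).
  have := hr (u - t) ltac:(rewrite ltr_norml; lra).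
  rewrite !(addrC t) !subrK [`|u - t|]ler0_norm ?subr_le0//.
  rewrite [`|v - t|]ger0_norm ?subr_ge0// => h1 h2.
  have -> : f v - f u - (v - u) *: p = (f v - f t - (v - t) *: w) -
      (f u - f t - (u - t) *: w) + (v - u) *: (w - p).
    rewrite -subrACA -scalerBl opprB (addrA (f v - f t)) subrK.
    have -> : v - t - (u - t) = v - u by ring.
    by rewrite scalerBr addrA subrK.
  rewrite (le_trans (ler_normD _ _))// mulrDl addrC lerD//.
    rewrite normrZ ger0_norm ?subr_ge0; last lra.
    by rewrite mulrC ler_wpM2r// subr_ge0; lra.
  by rewrite (le_trans (ler_normB _ _))//; lra.
have fd : forall (n : nat) (u v : 'I_n -> R),
    (forall i, a <= u i /\ u i <= v i /\ v i <= b) ->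
    trivIset [set: 'I_n] (fun i => `]u i, v i[%classic) ->
    \sum_(i < n) (v i - u i) < d ->
    \sum_(i < n) `|f (v i) - f (u i)| < e / 3.
  move=> n u v uv tuv luv; apply: fr => //.
  by rewrite (lt_le_trans luv)// ge_min lexx.
have [p Dp fp] := ae_mean_value_cover ab Dconv Dp0 K'0 good openU mU fd.
exists p => //; rewrite (le_trans fp)// mulrDl -!addrA lerD2l.
have h1 : e1 * (b - a) <= e / 3.
  by rewrite /e1 mulrAC ler_pdivrMr// ler_pM2l; lra.
have h2 : d * `|p0| <= e / 3.
  rewrite (@le_trans _ _ (e / 3 / (`|p0| + 1) * `|p0|))//.
    by rewrite ler_wpM2r// ge_min lexx orbT.
  by rewrite mulrAC ler_pdivrMr// ler_pM2l; lra.
lra.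
Qed.

(** * Laws and their solutions *)

Section expR_estimates.
Context {R : realType}.
Implicit Types x y : R.

Lemma expR_mulDl x y : expR x * (1 + y) <= expR (x + y).
Proof. by rewrite expRD ler_wpM2l ?expR_ge0// expR_ge1Dx. Qed.

Lemma expR_sub1_le y : expR y - 1 <= y * expR y.
Proof.
have := expR_mulDl y (- y); rewrite subrr expR0.
by rewrite mulrDr mulr1 mulrN (mulrC y); lra.
Qed.

Lemma expR_sub1Dx_le y : 0 <= y -> expR y - 1 - y <= y ^+ 2 * expR y.
Proof.
move=> y0; rewrite expr2 -mulrA.
have := ler_wpM2l y0 (expR_sub1_le y); have := expR_sub1_le y; lra.
Qed.

Lemma expR_ge1 y : 0 <= y -> 1 <= expR y.
Proof. by move=> y0; have := expR_ge1Dx y; lra. Qed.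

End expR_estimates.

Section linear_laws.
Context {R : realType} {d : nat}.
Variables (A : set 'M[R]_d) (L : R) (B0 : 'M[R]_d).
Hypotheses (A0 : A B0) (Acomp : compact A).
Hypothesis Aconv : forall p q l, A p -> A q -> 0 <= l <= 1 ->
  A (l *: p + (1 - l) *: q).
Hypothesis AL : forall B, A B -> `|B| <= L.
Hypothesis AmL : forall B (v : 'cV[R]_d), A B -> `|B *m v| <= L * `|v|.

Implicit Types (F : R -> 'M[R]_d) (x : R -> 'cV[R]_d).

Let L0 : 0 <= L. Proof. exact: le_trans (normr_ge0 _) (AL A0). Qed.

(* This remainder is exactly stable under concatenation: growth (a + b) =
   growth b * expR (L * a) + growth a + L * b * (expR (L * a) - 1). *)
Definition growth (h : R) := expR (L * h) - 1 - L * h.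

Lemma growth_ge0 h : 0 <= growth h.
Proof. by have := expR_ge1Dx (L * h); rewrite /growth; lra. Qed.

Lemma growth_add a b : 0 <= a -> 0 <= b ->
  growth a * (1 + L * b) + (L * a) * (L * b) <= growth (a + b).
Proof.
move=> a0 b0; rewrite /growth (mulrDr L a b).
have := expR_mulDl (L * a) (L * b); lra.
Qed.

(* F stands for a primitive of the switching law, and x for a solution of
   dx = dF x, on [0, T]. *)
Definition law_on (T : R) F := forall s t, 0 <= s -> s <= t -> t <= T ->
  exists2 B, A B & F t - F s = (t - s) *: B.

Definition sol_on (T : R) F x := forall s t, 0 <= s -> s <= t -> t <= T ->
  `|x t - x s - (F t - F s) *m x s| <= growth (t - s) * `|x s|.

Lemma convex_comb a b p q : A p -> A q -> 0 <= a -> 0 <= b ->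
  exists2 r, A r & a *: p + b *: q = (a + b) *: r.
Proof.
move=> Ap Aq a0 b0; have [ab|ab] := ltP 0 (a + b); last first.
  exists p => //; have -> : a = 0 by lra.
  by have -> : b = 0; [lra|rewrite addr0 !scale0r addr0].
exists ((a / (a + b)) *: p + (1 - a / (a + b)) *: q).
  apply: Aconv => //; rewrite divr_ge0 ?(ltW ab)//=.
  by rewrite ler_pdivrMr// mul1r lerDl.
rewrite scalerDr !scalerA; have ab0 : a + b != 0 by rewrite gt_eqF.
by congr (_ *: _ + _ *: _); field.
Qed.

Let telescope_error (p q r u v w : 'cV[R]_d) :
  p - r - (u + v) = (p - q - w) + (q - r - v) + (w - u).
Proof. by apply/colP => i; rewrite !mxE; ring. Qed.

Section grid.
Variables (z : nat -> 'cV[R]_d) (G : nat -> 'M[R]_d) (k c : R) (N : nat).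
Hypotheses (k0 : 0 <= k) (c0 : 0 <= c).
Hypothesis GA : forall j, (j < N)%N -> exists2 B, A B & G j.+1 - G j = k *: B.

Lemma grid_law j : (j <= N)%N -> exists2 B, A B & G j - G 0 = (j%:R * k) *: B.
Proof.
elim: j => [_|j ih jN]; first by exists B0; rewrite // mul0r scale0r subrr.
have [B AB BE] := ih (ltnW jN); have [B' AB' BE'] := GA jN.
have [B1 AB1 B1E] := @convex_comb (j%:R * k) k B B' AB AB' ltac:(by rewrite mulr_ge0) k0.
exists B1 => //; rewrite -natr1 mulrDl mul1r -B1E -BE -BE'.
by rewrite [RHS]addrC addrA subrK.
Qed.

Hypothesis zc : forall j, (j < N)%N ->
  `|z j.+1 - z j - (G j.+1 - G j) *m z j| <= c.

(** A discrete Gronwall estimate: the local defects c add up and are amplified by an exponential at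
    most, while [growth_add] absorbs at each step the cost of linearizing at the first node. *)
Lemma grid_estimate j : (j <= N)%N ->
  `|z j - z 0 - (G j - G 0) *m z 0| <=
  growth (j%:R * k) * `|z 0| + j%:R * c * expR (L * (j%:R * k)).
Proof.
elim: j => [_|j ih jN].
  by rewrite !subrr mul0mx subr0 normr0 !mul0r addr0 mulr_ge0// growth_ge0.
have {}ih := ih (ltnW jN).
have [B AB BE] := GA jN; have [Bj ABj BjE] := grid_law (ltnW jN).
have -> : z j.+1 - z 0%N - (G j.+1 - G 0%N) *m z 0%N =
    (z j.+1 - z j - (G j.+1 - G j) *m z j) +
    (z j - z 0%N - (G j - G 0%N) *m z 0%N) +
    (G j.+1 - G j) *m (z j - z 0%N).
  have -> : G j.+1 - G 0%N = (G j.+1 - G j) + (G j - G 0%N) by rewrite addrA subrK.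
  by rewrite mulmxDl mulmxBr; exact: telescope_error.
have zj : `|z j - z 0%N| <= growth (j%:R * k) * `|z 0%N| +
    j%:R * c * expR (L * (j%:R * k)) + L * (j%:R * k) * `|z 0%N|.
  rewrite -[z j - z 0%N](subrK ((G j - G 0%N) *m z 0%N)).
  rewrite (le_trans (ler_normD _ _))// lerD// BjE -scalemxAl normrZ.
  have jk0 : 0 <= j%:R * k by rewrite mulr_ge0.
  rewrite ger0_norm// (le_trans (ler_wpM2l jk0 (AmL _ ABj)))//.
  by rewrite mulrCA mulrA.
have BjL : `|(G j.+1 - G j) *m (z j - z 0%N)| <= L * k * `|z j - z 0%N|.
  rewrite BE -scalemxAl normrZ ger0_norm// (le_trans (ler_wpM2l k0 (AmL _ AB)))//.
  by rewrite mulrCA mulrA.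
rewrite (le_trans (ler_normD _ _))//.
rewrite (le_trans (lerD (ler_normD _ _) (lexx _)))//.
set a := j%:R * k.
have a0 : 0 <= a by rewrite mulr_ge0.
have -> : j.+1%:R * k = a + k by rewrite -natr1 mulrDl mul1r.
have E1 := expR_mulDl (L * a) (L * k).
have E2 : 1 <= expR (L * (a + k)) by rewrite expR_ge1// !mulr_ge0// addr_ge0.
have E3 := growth_add a0 k0.
have := zc jN; have := ler_wpM2l (mulr_ge0 L0 k0) zj.
rewrite -/a in zj ih BjL E1 E2 E3 *.
rewrite -mulrDr in E1.
have F1 := ler_wpM2r (normr_ge0 (z 0%N)) E3.
have F2 := ler_wpM2l (mulr_ge0 (ler0n R j) c0) E1.
have F3 := ler_wpM2l c0 E2.
rewrite -natr1.
move: (`|z 0%N|) (`|z j - z 0%N|) F1 F2 F3 ih BjL => z0 zz.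
move: (`|z j - _ - _|) (`|(_ - _) *m (_ - _)|) (`|z j.+1 - z j - _|) => q1 q2 q3.
move: (growth a) (growth (a + k)) (expR (L * a)) (expR (L * (a + k))) (j%:R : R).
move=> ga gak ea eak J F1 F2 F3 ih BjL H1 H2.
nra.
Qed.

End grid.

Section solutions.
Variables (T : R) (F : R -> 'M[R]_d).
Hypothesis lawF : law_on T F.

Lemma law_mulmx_le s t (v : 'cV[R]_d) : 0 <= s -> s <= t -> t <= T ->
  `|(F t - F s) *m v| <= L * (t - s) * `|v|.
Proof.
move=> s0 st tT; have [B AB ->] := lawF s0 st tT.
rewrite -scalemxAl normrZ ger0_norm ?subr_ge0// -mulrA mulrCA.
by rewrite ler_wpM2l ?subr_ge0// AmL.
Qed.

Lemma law_norm_le s t : 0 <= s -> s <= t -> t <= T ->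
  `|F t - F s| <= L * (t - s).
Proof.
move=> s0 st tT; have [B AB ->] := lawF s0 st tT.
by rewrite normrZ ger0_norm ?subr_ge0// mulrC ler_wpM2r ?subr_ge0// AL.
Qed.

Lemma sol_sub_le x s t : sol_on T F x -> 0 <= s -> s <= t -> t <= T ->
  `|x t - x s| <= (expR (L * (t - s)) - 1) * `|x s|.
Proof.
move=> solx s0 st tT; rewrite -[x t - x s](subrK ((F t - F s) *m x s)).
rewrite (le_trans (ler_normD _ _))//.
rewrite (le_trans (lerD (solx _ _ s0 st tT) (law_mulmx_le _ s0 st tT)))//.
by rewrite -mulrDl /growth subrK.
Qed.

Lemma sol_le x s t : sol_on T F x -> 0 <= s -> s <= t -> t <= T ->
  `|x t| <= expR (L * (t - s)) * `|x s|.
Proof.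
move=> solx s0 st tT; have := sol_sub_le solx s0 st tT.
have := ler_normD (x t - x s) (x s); rewrite subrK; lra.
Qed.

(* The bound in [sol_on] is not additive in x, but the quadratic one is: this
   self-improvement makes differences of solutions solutions. *)
Lemma sol_of_quadratic x (C : R) : 0 <= C ->
  (forall s t, 0 <= s -> s <= t -> t <= T ->
    `|x t - x s - (F t - F s) *m x s| <= C * (t - s) ^+ 2) ->
  sol_on T F x.
Proof.
move=> C0 xC s t s0 st tT.
pose D := C * (t - s) ^+ 2 * expR (L * (t - s)).
have D0 : 0 <= D by rewrite /D !mulr_ge0 ?expR_ge0 ?subr_ge0.
(* On [N.+1] equal steps of length k the quadratic errors sum to [N.+1 * C * k ^+ 2], of order
   [1 / N]; letting N grow leaves only the [growth] term. *)
have xN N : `|x t - x s - (F t - F s) *m x s| <=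
    growth (t - s) * `|x s| + D / N.+1%:R.
  pose k := (t - s) / N.+1%:R.
  have N0 : N.+1%:R != 0 :> R by rewrite pnatr_eq0.
  have k0 : 0 <= k by rewrite divr_ge0 ?subr_ge0.
  have Nk : N.+1%:R * k = t - s by rewrite mulrC divfK.
  pose r j := s + j%:R * k.
  have rT j : (j < N.+1)%N -> r j.+1 <= T.
    move=> jN; rewrite (le_trans _ tT)// -lerBrDl -Nk ler_wpM2r//.
    by rewrite ler_nat.
  have r0 j : 0 <= r j by rewrite addr_ge0// mulr_ge0.
  have rr j : r j.+1 - r j = k by rewrite /r -natr1; ring.
  have rle j : r j <= r j.+1 by rewrite -subr_ge0 rr.
  have GA j : (j < N.+1)%N -> exists2 B, A B & F (r j.+1) - F (r j) = k *: B.
    by move=> jN; rewrite -(rr j); apply: lawF => //; exact: rT.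
  have xr j : (j < N.+1)%N -> `|x (r j.+1) - x (r j) -
      (F (r j.+1) - F (r j)) *m x (r j)| <= C * k ^+ 2.
    by move=> jN; rewrite -(rr j); apply: xC => //; exact: rT.
  have := grid_estimate (z := x \o r) (G := F \o r) k0
    (mulr_ge0 C0 (sqr_ge0 k)) GA xr (leqnn _) => /=.
  have -> : r 0%N = s by rewrite /r mul0r addr0.
  have -> : r N.+1 = t by rewrite /r Nk addrC subrK.
  rewrite /= Nk; congr (_ <= _ + _).
  by rewrite /D /k; field.
apply/ler_addgt0Pr => e e0.
have [N Ne] : exists N, D / N.+1%:R <= e.
  exists (Num.truncn (D / e)); rewrite ler_pdivrMr// mulrC -ler_pdivrMr//.
  by have /andP[_ /ltW] := truncn_itv (divr_ge0 D0 (ltW e0)).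
by rewrite (le_trans (xN N))// lerD2l.
Qed.

End solutions.

Lemma law_onW S T F : S <= T -> law_on T F -> law_on S F.
Proof. by move=> ST h s t s0 st tS; apply: h => //; exact: le_trans ST. Qed.

Lemma sol_onW S T F x : S <= T -> sol_on T F x -> sol_on S F x.
Proof. by move=> ST h s t s0 st tS; apply: h => //; exact: le_trans ST. Qed.

Lemma growth_quadratic T h : 0 <= h -> h <= T ->
  growth h <= L ^+ 2 * expR (L * T) * h ^+ 2.
Proof.
move=> h0 hT; rewrite (le_trans (expR_sub1Dx_le (mulr_ge0 L0 h0)))//.
rewrite exprMn mulrAC ler_wpM2r ?sqr_ge0// ler_wpM2l ?sqr_ge0//.
by rewrite ler_expR ler_wpM2l.
Qed.

(** On [[0, T]] solutions are bounded and [growth] is quadratic, so the errors of x and y have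
    quadratic bounds; these add up, and [sol_of_quadratic] restores the sharp form. *)
Lemma sol_onB T F x y : law_on T F -> sol_on T F x -> sol_on T F y ->
  sol_on T F (x - y).
Proof.
move=> lawF solx soly.
have [T0|T0] := ltP T 0.
  by move=> s t s0 st tT; have := le_lt_trans (le_trans (le_trans s0 st) tT) T0; rewrite ltxx.
pose M := expR (L * T) * (`|x 0| + `|y 0|).
apply: (@sol_of_quadratic _ _ lawF _ (L ^+ 2 * expR (L * T) * M)).
  by rewrite !mulr_ge0 ?sqr_ge0 ?expR_ge0// addr_ge0.
move=> s t s0 st tT; rewrite !fctE.
have -> : x t - y t - (x s - y s) - (F t - F s) *m (x s - y s) =
    (x t - x s - (F t - F s) *m x s) - (y t - y s - (F t - F s) *m y s).
  by rewrite mulmxBr; apply/colP => i; rewrite !mxE; ring.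
have sT : s <= T by exact: le_trans tT.
have Ms : `|x s| + `|y s| <= M.
  have := sol_le lawF solx (lexx 0) s0 sT.
  have := sol_le lawF soly (lexx 0) s0 sT.
  rewrite subr0 => y1 x1; rewrite (le_trans (lerD x1 y1))// -mulrDr.
  by rewrite ler_wpM2r ?addr_ge0// ler_expR ler_wpM2l.
rewrite (le_trans (ler_normB _ _))//.
rewrite (le_trans (lerD (solx _ _ s0 st tT) (soly _ _ s0 st tT)))// -mulrDr.
have h0 : 0 <= t - s by rewrite subr_ge0.
have hT : t - s <= T by lra.
rewrite (le_trans (ler_pM (growth_ge0 _) _ (growth_quadratic h0 hT) Ms)) ?addr_ge0//.
by rewrite mulrAC.
Qed.


(** * Limits of laws and solutions along an ultrafilter *)

Section ultralimit_solutions.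
Variables (U : set_system nat) (UU : UltraFilter U) (Uoo : \oo `<=` U).

Lemma cvg_ultra (S : topologicalType) (u : nat -> S) (l : S) :
  u @ \oo --> l -> u @ U --> l.
Proof. by move=> ul V /ul/Uoo. Qed.

(** The slopes converge along U inside the compact set A; [B0] stands in for those n where no slope
    is given. *)
Lemma law_lim (c : nat -> R) (c0 : R) (D : nat -> 'M[R]_d) (D0 : 'M[R]_d) :
  c @ U --> c0 -> D @ U --> D0 ->
  (\forall n \near U, exists2 B, A B & D n = c n *: B) ->
  exists2 B, A B & D0 = c0 *: B.
Proof.
move=> cc0 DD0 DA.
have h n : {B | (exists2 B, A B & D n = c n *: B) -> A B /\ D n = c n *: B}.
  apply: cid; have [[B AB E]|nB] := pselect (exists2 B, A B & D n = c n *: B).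
    by exists B.
  by exists B0.
have [B AB BB] : exists2 B, A B & sval (h n) @[n --> U] --> B.
  apply: compact_ultra_cvg Acomp _; apply: filterS DA => n DA.
  by case: (svalP (h n)).
exists B => //; apply: (cvg_unique (@norm_hausdorff _ _) DD0).
apply: cvg_trans (cvgZ cc0 BB); apply: near_eq_cvg.
by apply: filterS DA => n /(svalP (h n)) [].
Qed.

Lemma sol_lim (a b : nat -> 'cV[R]_d) (D : nat -> 'M[R]_d) (r : nat -> R)
    (a0 b0 : 'cV[R]_d) (D0 : 'M[R]_d) (r0 : R) :
  a @ U --> a0 -> b @ U --> b0 -> D @ U --> D0 -> r @ U --> r0 ->
  (\forall n \near U, `|a n - b n - D n *m b n| <= r n) ->
  `|a0 - b0 - D0 *m b0| <= r0.
Proof.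
move=> aa bb DD rr; apply: ler_cvg_to rr.
by apply: cvg_norm; apply: cvgB; [exact: cvgB|exact: cvg_mulmx].
Qed.

Definition grid_index (n : nat) (t : R) := Num.truncn (t * n.+1%:R).
Definition grid_node n t := (grid_index n t)%:R / n.+1%:R :> R.

Lemma grid_node_le n t : 0 <= t -> grid_node n t <= t.
Proof.
move=> t0; rewrite /grid_node ler_pdivrMr//.
by have /andP[] := truncn_itv (mulr_ge0 t0 (ler0n R n.+1)).
Qed.

Lemma lt_grid_node n t : 0 <= t -> t < grid_node n t + n.+1%:R^-1.
Proof.
move=> t0; rewrite /grid_node -[X in _ + X]mul1r -mulrDl natr1 ltr_pdivlMr//.
by have /andP[] := truncn_itv (mulr_ge0 t0 (ler0n R n.+1)).
Qed.

Lemma cvg_invS : n.+1%:R^-1 @[n --> U] --> (0 : R).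
Proof. exact: cvg_ultra (@cvg_harmonic R). Qed.

Lemma cvg_grid_node t : 0 <= t -> grid_node n t @[n --> U] --> t.
Proof.
move=> t0; apply/cvgrPdist_lt => e e0.
have /cvgrPdist_lt/(_ _ e0) := cvg_invS; apply: filterS => n.
rewrite sub0r normrN ger0_norm// => ne.
have := grid_node_le n t0; have := lt_grid_node n t0 => h1 h2.
by rewrite ger0_norm ?subr_ge0// ltrBlDl (lt_trans h1)// ltrD2l.
Qed.

Lemma cvg_growth (u : nat -> R) (l : R) : u @ U --> l ->
  growth (u n) @[n --> U] --> growth l.
Proof.
move=> ul; have Lu : L * u n @[n --> U] --> L * l by apply: cvgMl_tmp.
apply: cvgB => //; apply: cvgB; last exact: cvg_cst.
by apply: (continuous_cvg _ (@continuous_expR R _)).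
Qed.

(** [law_norm_le] and [sol_le] bound the values at each time, so pointwise limits exist, and the
    defining conditions are closed. The horizon may depend on n: each T has only to be covered for
    U-almost all n. *)
Lemma law_sol_compact (Fn : nat -> R -> 'M[R]_d) (xn : nat -> R -> 'cV[R]_d)
    (c : R) :
  (forall n, Fn n 0 = 0) -> (\forall n \near U, `|xn n 0| <= c) ->
  (forall T, \forall n \near U, law_on T (Fn n) /\ sol_on T (Fn n) (xn n)) ->
  exists F, exists2 x, [/\ F 0 = 0, forall T, law_on T F & forall T, sol_on T F x] &
    forall t, 0 <= t -> xn n t @[n --> U] --> x t.
Proof.
move=> Fn0 xc h.
have hF t : {l | 0 <= t -> Fn n t @[n --> U] --> (l : 'M[R]_d)}.
  apply: cid; have [t0|t0] := leP 0 t; last by exists 0.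
  have [l ll] : exists l : 'M[R]_d, Fn n t @[n --> U] --> l; last by exists l.
  apply: (@mx_ultra_cvg _ _ _ _ _ _ _ (L * t)); apply: filterS (h t) => n [lawn _].
  by have := law_norm_le lawn (lexx 0) t0 (lexx t); rewrite Fn0 !subr0.
have hx t : {l | 0 <= t -> xn n t @[n --> U] --> (l : 'cV[R]_d)}.
  apply: cid; have [t0|t0] := leP 0 t; last by exists 0.
  have [l ll] : exists l : 'cV[R]_d, xn n t @[n --> U] --> l; last by exists l.
  apply: (@mx_ultra_cvg _ _ _ _ _ _ _ (expR (L * t) * c)).
  apply: filterS2 (h t) xc => n [lawn soln] xnc.
  have := sol_le lawn soln (lexx 0) t0 (lexx t); rewrite subr0 => /le_trans; apply.
  by rewrite ler_wpM2l// expR_ge0.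
exists (fun t => sval (hF t)); exists (fun t => sval (hx t)); last first.
  by move=> t t0; exact: (svalP (hx t)).
split.
- have F00 : Fn n 0 @[n --> U] --> (0 : 'M[R]_d).
    rewrite (_ : (fun n => Fn n 0) = fun=> 0); first exact: cvg_cst.
    by apply/funext.
  exact: (cvg_unique (@norm_hausdorff _ _) (svalP (hF 0) (lexx 0)) F00).
- move=> T s t s0 st tT; have t0 := le_trans s0 st.
  apply: (@law_lim (fun=> t - s) (t - s) (fun n => Fn n t - Fn n s)).
  + exact: cvg_cst.
  + by apply: cvgB; [exact: (svalP (hF t))|exact: (svalP (hF s))].
  + by apply: filterS (h T) => n [lawn _]; exact: lawn.
- move=> T s t s0 st tT; have t0 := le_trans s0 st.
  apply: (@sol_lim (xn ^~ t) (xn ^~ s) (fun n => Fn n t - Fn n s)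
    (fun n => growth (t - s) * `|xn n s|)).
  + exact: (svalP (hx t)).
  + exact: (svalP (hx s)).
  + by apply: cvgB; [exact: (svalP (hF t))|exact: (svalP (hF s))].
  + by apply: cvgMl_tmp; apply: cvg_norm; exact: (svalP (hx s)).
  + by apply: filterS (h T) => n [_ soln]; exact: soln.
Qed.


Fixpoint euler (G : nat -> 'M[R]_d) (v : 'cV[R]_d) (j : nat) : 'cV[R]_d :=
  if j is j'.+1 then euler G v j' + (G j'.+1 - G j') *m euler G v j' else v.

Lemma le_grid_index n s t : s <= t -> (grid_index n s <= grid_index n t)%N.
Proof. by move=> st; apply: le_truncn; rewrite ler_wpM2r. Qed.

(** Euler schemes along F on the grids of step [1 / n.+1] satisfy [grid_estimate] with zero defect,
    and their pointwise limit inherits the bound of [sol_on]. *)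
Lemma sol_exists F (v : 'cV[R]_d) : (forall T, law_on T F) ->
  exists2 y, y 0 = v & forall T, sol_on T F y.
Proof.
move=> lawF.
pose k n : R := n.+1%:R^-1.
have k0 n : 0 <= k n by rewrite invr_ge0.
pose G n j := F (j%:R * k n).
pose Y n j := euler (G n) v j.
have GA n i j : exists2 B, A B & G n (i + j.+1)%N - G n (i + j)%N = k n *: B.
  have [] := lawF ((i + j.+1)%N%:R * k n) ((i + j)%N%:R * k n)
    ((i + j.+1)%N%:R * k n) => //.
  - by rewrite mulr_ge0.
  - by rewrite ler_wpM2r// ler_nat leq_add2l.
  - move=> B AB E; exists B => //; rewrite E; congr (_ *: _).
    by rewrite -mulrBl -natrB ?leq_add2l// subnDl subSnn mul1r.
have YE n i j : `|Y n (i + j)%N - Y n i - (G n (i + j)%N - G n i) *m Y n i| <=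
    growth (j%:R * k n) * `|Y n i|.
  have := @grid_estimate (fun j => Y n (i + j)%N) (fun j => G n (i + j)%N) (k n) 0 j
    (k0 n) (lexx 0) (fun j _ => GA n i j) _ j (leqnn j).
  rewrite mulr0 mul0r addr0 addn0; apply => {}j _; rewrite addnS.
  by rewrite /Y /= [_ + _ *m _]addrC addrK subrr normr0.
have Yle n j : `|Y n j| <= expR (L * (j%:R * k n)) * `|v|.
  have := YE n 0%N j; rewrite !add0n => h.
  have := law_mulmx_le (lawF (j%:R * k n)) v (lexx 0) (mulr_ge0 (ler0n _ j) (k0 n)) (lexx _).
  move: h; rewrite /growth /G mul0r subr0 -/(G n j) [Y n 0%N]/=.
  set a := (_ - F 0) *m v => h1 h2.
  have := ler_normD (Y n j - v - a) (a + v); rewrite addrA !subrK.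
  have := ler_normD a v; lra.
pose y n t := Y n (grid_index n t).
have hy t : {l | 0 <= t -> y n t @[n --> U] --> (l : 'cV[R]_d)}.
  apply: cid; have [t0|t0] := leP 0 t; last by exists 0.
  have [l ll] : exists l : 'cV[R]_d, y n t @[n --> U] --> l; last by exists l.
  apply: (@mx_ultra_cvg _ _ _ _ _ _ _ (expR (L * t) * `|v|)); apply: nearW => n.
  rewrite (le_trans (Yle _ _))// ler_wpM2r// ler_expR ler_wpM2l//.
  exact: grid_node_le.
have Gcvg t : 0 <= t -> G n (grid_index n t) @[n --> U] --> F t.
  move=> t0; apply/cvgrPdist_le => e e0.
  have : L * (t - grid_node n t) @[n --> U] --> L * (t - t).
    by apply: cvgMl_tmp; apply: cvgB; [exact: cvg_cst|exact: cvg_grid_node].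
  rewrite subrr mulr0 => /cvgrPdist_le/(_ _ e0); apply: filterS => n.
  rewrite sub0r normrN ger0_norm; last first.
    by rewrite mulr_ge0// subr_ge0 grid_node_le.
  apply: le_trans; apply: (law_norm_le (lawF t)) => //; last exact: grid_node_le.
  by rewrite mulr_ge0.
exists (fun t => sval (hy t)).
  have y0 : y n 0 @[n --> U] --> v.
    rewrite (_ : (fun n => y n 0) = fun=> v); first exact: cvg_cst.
    by apply/funext => n; rewrite /y /grid_index mul0r truncn0.
  exact: (cvg_unique (@norm_hausdorff _ _) (svalP (hy 0) (lexx 0)) y0).
move=> T s t s0 st _; have t0 := le_trans s0 st.
apply: (@sol_lim (y ^~ t) (y ^~ s)
  (fun n => G n (grid_index n t) - G n (grid_index n s))
  (fun n => growth (grid_node n t - grid_node n s) * `|y n s|)).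
- exact: (svalP (hy t)).
- exact: (svalP (hy s)).
- by apply: cvgB; exact: Gcvg.
- apply: cvgM; last by apply: cvg_norm; exact: (svalP (hy s)).
  by apply: cvg_growth; apply: cvgB; exact: cvg_grid_node.
- apply: nearW => n; have := YE n (grid_index n s) (grid_index n t - grid_index n s)%N.
  by rewrite subnKC ?le_grid_index// natrB ?le_grid_index// (mulrBl (k n)).
Qed.

(* F is the limit of piecewise constant primitives on finer and finer grids,
   with slopes given by the inclusion. *)
Lemma law_of_inclusion (T C K : R) x : 0 <= C -> 0 <= K ->
  (forall s t, 0 <= s -> s <= t -> t <= T -> `|x t - x s| <= K * (t - s)) ->
  (forall s t, 0 <= s -> s <= t -> t <= T ->
    exists2 B, A B & `|x t - x s - (t - s) *: (B *m x s)| <= C * (t - s) ^+ 2) ->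
  exists F, [/\ F 0 = 0, law_on T F & sol_on T F x].
Proof.
move=> C0 K0 xK xC.
pose k n : R := n.+1%:R^-1.
have k0 n : 0 <= k n by rewrite invr_ge0.
(* Grid intervals that end beyond T get the slope [B0], so that all slopes lie in A. *)
have hB n j : {B | A B & j.+1%:R * k n <= T ->
    `|x (j.+1%:R * k n) - x (j%:R * k n) - k n *: (B *m x (j%:R * k n))| <=
      C * (k n) ^+ 2}.
  apply: cid2; have [jT|_] := leP (j.+1%:R * k n) T; last by exists B0.
  have [] := xC (j%:R * k n) (j.+1%:R * k n) => //.
  - by rewrite mulr_ge0.
  - by rewrite ler_wpM2r// ler_nat.
  - by rewrite -mulrBl -natrB// subSnn mul1r => B AB h; exists B.
pose B n j := s2val (hB n j).
have AB n j : A (B n j) := s2valP (hB n j).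
pose G n j := \sum_(i < j) k n *: B n i.
have GS n j : G n j.+1 - G n j = k n *: B n j.
  by rewrite /G big_ord_recr/= [X in X - _]addrC addrK.
have GA n i j : exists2 B, A B & G n (i + j)%N - G n i = (j%:R * k n) *: B.
  have := @grid_law (fun j => G n (i + j)%N) (k n) j (k0 n) _ j (leqnn j).
  rewrite addn0; apply => {}j _; exists (B n (i + j)%N) => //.
  by rewrite addnS GS.
pose Fn n t := G n (grid_index n t).
have hF t : {l | 0 <= t -> Fn n t @[n --> U] --> (l : 'M[R]_d)}.
  apply: cid; have [t0|t0] := leP 0 t; last by exists 0.
  have [l ll] : exists l : 'M[R]_d, Fn n t @[n --> U] --> l; last by exists l.
  apply: (@mx_ultra_cvg _ _ _ _ _ _ _ (t * L)); apply: nearW => n.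
  have [B' AB'] := GA n 0%N (grid_index n t).
  rewrite add0n {2}/G big_ord0 subr0 /Fn => ->.
  rewrite normrZ ger0_norm ?mulr_ge0// ler_pM ?mulr_ge0 ?AL//.
  exact: grid_node_le.
have node t (t0 : 0 <= t) n : 0 <= grid_node n t <= t.
  by rewrite grid_node_le// mulr_ge0.
have xcvg t : 0 <= t -> t <= T -> x (grid_node n t) @[n --> U] --> x t.
  move=> t0 tT; apply/cvgrPdist_le => e e0.
  have : K * (t - grid_node n t) @[n --> U] --> K * (t - t).
    by apply: cvgMl_tmp; apply: cvgB; [exact: cvg_cst|exact: cvg_grid_node].
  rewrite subrr mulr0 => /cvgrPdist_le/(_ _ e0); apply: filterS => n.
  have /andP[n0 nt] := node t t0 n.
  rewrite sub0r normrN ger0_norm; last by rewrite mulr_ge0// subr_ge0.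
  by apply: le_trans; apply: xK.
exists (fun t => sval (hF t)).
have lawF : law_on T (fun t => sval (hF t)).
  move=> s t s0 st tT; have t0 := le_trans s0 st.
  apply: (@law_lim (fun n => grid_node n t - grid_node n s) _
      (fun n => Fn n t - Fn n s)).
  - by apply: cvgB; exact: cvg_grid_node.
  - by apply: cvgB; [exact: (svalP (hF t))|exact: (svalP (hF s))].
  apply: nearW => n.
  have [B' AB'] := GA n (grid_index n s) (grid_index n t - grid_index n s)%N.
  rewrite subnKC ?le_grid_index// natrB ?le_grid_index// mulrBl => E.
  by exists B'.
split => //.
  have F00 : Fn n 0 @[n --> U] --> (0 : 'M[R]_d).
    rewrite (_ : (fun n => Fn n 0) = fun=> 0); first exact: cvg_cst.
    by apply/funext => n; rewrite /Fn /grid_index mul0r truncn0 /G big_ord0.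
  exact: (cvg_unique (@norm_hausdorff _ _) (svalP (hF 0) (lexx 0)) F00).
apply: (sol_of_quadratic lawF (C := L * K)); first by rewrite mulr_ge0.
move=> s t s0 st tT; have t0 := le_trans s0 st.
have sT := le_trans st tT.
(* Over j steps the local defects add up to [j * C * k ^+ 2], which vanishes in the limit, and
   freezing x at the first node costs [L * K] times the squared length; this quadratic term is what
   remains for [sol_of_quadratic]. *)
have E n i j : (i + j)%N%:R * k n <= T ->
  `|x ((i + j)%N%:R * k n) - x (i%:R * k n) - (G n (i + j)%N - G n i) *m x (i%:R * k n)|
   <= j%:R * (C * k n ^+ 2) + L * K * (j%:R * k n) ^+ 2.
  elim: j => [|j ih] ijT.
    by rewrite addn0 !subrr mul0mx subr0 normr0 !mul0r expr0n/= mulr0 addr0.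
  rewrite addnS in ijT *.
  have ij1 : (i + j)%N%:R * k n <= (i + j).+1%:R * k n.
    by rewrite ler_wpM2r// ler_nat.
  have i1 : i%:R * k n <= (i + j)%N%:R * k n.
    by rewrite ler_wpM2r// ler_nat leq_addr.
  have {}ih := ih (le_trans ij1 ijT).
  have -> : G n (i + j).+1 - G n i = (G n (i + j).+1 - G n (i + j)%N) +
    (G n (i + j)%N - G n i) by rewrite addrA subrK.
  rewrite mulmxDl (telescope_error _ (x ((i + j)%N%:R * k n)) _ _ _
    ((G n (i + j).+1 - G n (i + j)%N) *m x ((i + j)%N%:R * k n))) -mulmxBr.
  rewrite (le_trans (ler_normD _ _))//.
  rewrite (le_trans (lerD (ler_normD _ _) (lexx _)))//.
  have h1 := s2valP' (hB n (i + j)%N) ijT.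
  have h2 : `|(G n (i + j).+1 - G n (i + j)%N) *m
      (x ((i + j)%N%:R * k n) - x (i%:R * k n))| <= k n * (L * (K * (j%:R * k n))).
    rewrite GS -scalemxAl normrZ ger0_norm// ler_wpM2l//.
    rewrite (le_trans (AmL _ (AB n _)))// ler_wpM2l//.
    rewrite (le_trans (xK _ _ _ i1 (le_trans ij1 ijT))) ?mulr_ge0//.
    by rewrite ler_wpM2l// natrD mulrDl addrC addKr.
  rewrite -/(B n (i + j)%N) scalemxAl -GS in h1.
  move: ih h1 h2.
  move: (`|_|) (`|_|) (`|_|) => q1 q2 q3 ih h1 h2.
  rewrite -[j.+1%:R]natr1.
  have LK0 : 0 <= L * K by rewrite mulr_ge0.
  have kk0 : 0 <= k n * k n by rewrite mulr_ge0.
  have LKk : 0 <= L * K * (k n * k n) by rewrite mulr_ge0.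
  have LKj : 0 <= j%:R * (L * K * (k n * k n)) by rewrite mulr_ge0.
  nra.
apply: (@sol_lim (fun n => x (grid_node n t)) (fun n => x (grid_node n s))
  (fun n => Fn n t - Fn n s)
  (fun n => (grid_node n t - grid_node n s) * (C * k n) +
    L * K * (grid_node n t - grid_node n s) ^+ 2)).
- exact: xcvg.
- exact: xcvg.
- by apply: cvgB; [exact: (svalP (hF t))|exact: (svalP (hF s))].
- have ts : grid_node n t - grid_node n s @[n --> U] --> t - s.
    by apply: cvgB; exact: cvg_grid_node.
  rewrite -[X in _ --> X]add0r; apply: cvgD.
    rewrite -[X in _ --> X](mulr0 (t - s)); apply: cvgM => //.
    by rewrite -[X in _ --> X](mulr0 C); apply: cvgMl_tmp; exact: cvg_invS.
  by apply: cvgMl_tmp; apply: cvgM.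
- apply: nearW => n.
  have := E n (grid_index n s) (grid_index n t - grid_index n s)%N.
  rewrite subnKC ?le_grid_index// natrB ?le_grid_index// => /(_ _).
  have /andP[_ /le_trans/(_ tT) nt] := node t t0 n.
  move=> /(_ nt) /le_trans; apply.
  have -> : grid_node n t - grid_node n s =
    ((grid_index n t)%:R - (grid_index n s)%:R) * k n by rewrite (mulrBl (k n)).
  by rewrite le_eqVlt; apply/orP; left; apply/eqP; ring.
Qed.

End ultralimit_solutions.
End linear_laws.

(** * Trajectories are the solutions of laws *)

Lemma abs_continuous_onS (R : realType) (V : normedModType R) (a b c e : R)
    (f : R -> V) : a <= c -> e <= b -> abs_continuous_on a b f ->
  abs_continuous_on c e f.
Proof.
move=> ac eb fab eps eps0; have [r r0 h] := fab eps eps0; exists r => //.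
move=> n u v uv; apply: h => i; have [cu [uv' ve]] := uv i.
by split; [exact: le_trans cu|split => //; exact: le_trans eb].
Qed.

Lemma abs_continuous_on_dist (R : realType) (V : normedModType R) (a b : R)
    (f : R -> V) : abs_continuous_on a b f -> forall e : R, 0 < e ->
  exists2 r : R, 0 < r & forall s t, a <= s -> s <= t -> t <= b -> t - s < r ->
    `|f t - f s| < e.
Proof.
move=> fab e e0; have [r r0 h] := fab e e0; exists r => // s t sa st tb tsr.
have := h 1%N (fun=> s) (fun=> t); rewrite !big_ord1; apply => //.
by move=> i j _ _ _; rewrite !ord1.
Qed.

Lemma abs_continuous_on_bounded (R : realType) (V : normedModType R) (a b : R)
    (f : R -> V) : abs_continuous_on a b f ->
  exists2 M, 0 <= M & forall t, a <= t -> t <= b -> `|f t| <= M.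
Proof.
move=> /abs_continuous_on_dist/(_ 1 ltr01)[r r0 h].
have step j t : a <= t -> t <= b -> t <= a + j%:R * (r / 2) ->
    `|f t| <= `|f a| + j%:R.
  elim: j t => [|j ih] t at_ tb.
    by rewrite mul0r !addr0 => ta; have -> : t = a by apply/eqP; rewrite eq_le ta.
  move=> tj; have [ta|ta] := leP t (a + r / 2).
    have := h a t (lexx a) at_ tb ltac:(lra).
    have := ler_normD (f t - f a) (f a); rewrite subrK.
    by have : 0 <= j%:R :> R by []; rewrite -natr1; lra.
  have ta' : a <= t - r / 2 by lra.
  have := ih (t - r / 2) ta' ltac:(lra) ltac:(move: tj; rewrite -natr1; lra).
  have := h (t - r / 2) t ta' ltac:(lra) tb ltac:(lra).
  have := ler_normD (f t - f (t - r / 2)) (f (t - r / 2)); rewrite subrK.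
  by rewrite -natr1; lra.
pose N := (Num.truncn ((b - a) / (r / 2))).+1.
exists (`|f a| + N%:R); first by rewrite addr_ge0.
move=> t at_ tb; apply: step => //.
have ba : 0 <= b - a by rewrite subr_ge0 (le_trans at_).
have : b - a < N%:R * (r / 2).
  rewrite -ltr_pdivrMr ?divr_gt0//.
  by have /andP[] := truncn_itv (divr_ge0 ba (ltW (divr_gt0 r0 (@ltr0n R 2)))).
lra.
Qed.

Section bridge.
Context {R : realType} {d : nat}.
Variables (A : set 'M[R]_d) (L : R) (B0 : 'M[R]_d).
Hypotheses (A0 : A B0) (Acomp : compact A).
Hypothesis Aconv : forall p q l, A p -> A q -> 0 <= l <= 1 ->
  A (l *: p + (1 - l) *: q).
Hypothesis AL : forall B, A B -> `|B| <= L.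
Hypothesis AmL : forall B (v : 'cV[R]_d), A B -> `|B *m v| <= L * `|v|.

Let L0 : 0 <= L. Proof. exact: le_trans (normr_ge0 _) (AL A0). Qed.

(** The normalization [F 0 = 0] bounds F at each time, as limits of laws require, and fixes the
    value at the junction when laws are concatenated. *)
Definition law_solution (x : R -> 'cV[R]_d) := exists F,
  [/\ F 0 = 0, forall T, law_on A T F & forall T, sol_on L T F x].

(** [ae_mean_value] with D reduced to 0: the derivative is bounded by [L * M] almost everywhere. *)
Lemma trajectory_lipschitz T x : 0 <= T -> trajectory A x ->
  exists2 K, 0 <= K & forall s t, 0 <= s -> s <= t -> t <= T ->
    `|x t - x s| <= K * (t - s).
Proof.
move=> T0 [xac [a [aA _] dx]]; have {}xac := xac T T0.
have [M M0 xM] := abs_continuous_on_bounded xac.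
exists (L * M); first by rewrite mulr_ge0.
move=> s t s0 st tT; apply/ler_addgt0Pr => e e0.
have [|||||p -> h] := @ae_mean_value R _ x s t (L * M) [set 0] st _ _ _ _ _ e e0.
- by rewrite mulr_ge0.
- exact: abs_continuous_onS xac.
- by move=> p q l -> -> _ /=; rewrite !scaler0 addr0.
- by exists 0.
- apply: (filterS (Filter := ae_filter_ringOfSetsType _)) dx => u xu /andP[su ut].
  have u0 := le_trans s0 su.
  exists 0 => //; exists (a u *m x u); first exact: xu.
  rewrite subr0 (le_trans (AmL _ (aA u u0)))// ler_wpM2l// xM//.
  exact: le_trans tT.
- by rewrite scaler0 subr0 in h.
Qed.

(** [ae_mean_value] with D the convex set of the vectors [B *m x s]: on [[s, t]] the derivative
    [a u *m x u] is within [L * K * (t - s)] of [a u *m x s]. Compactness of A then removes the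
    extra error e. *)
Lemma trajectory_inclusion T K x : 0 <= T -> 0 <= K -> trajectory A x ->
  (forall s t, 0 <= s -> s <= t -> t <= T -> `|x t - x s| <= K * (t - s)) ->
  forall s t, 0 <= s -> s <= t -> t <= T ->
    exists2 B, A B & `|x t - x s - (t - s) *: (B *m x s)| <= L * K * (t - s) ^+ 2.
Proof.
move=> T0 K0 [xac [a [aA _] dx]] xK s t s0 st tT; have {}xac := xac T T0.
have ts0 : 0 <= t - s by rewrite subr_ge0.
have h e : 0 < e -> exists2 B, A B &
    `|x t - x s - (t - s) *: (B *m x s)| <= L * K * (t - s) ^+ 2 + e.
  move=> e0; have := @ae_mean_value R _ x s t (L * K * (t - s))
    [set B *m x s | B in A] st _ _ _ _ _ e e0.
  rewrite -[_ * (t - s) * _]mulrA -expr2 => h.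
  have [|||||_ [B AB <-] hB] := h; last by exists B.
  - by rewrite !mulr_ge0.
  - exact: abs_continuous_onS xac.
  - move=> _ _ l [p Ap <-] [q Aq <-] l01; exists (l *: p + (1 - l) *: q).
      exact: Aconv.
    by rewrite mulmxDl -!scalemxAl.
  - by exists (B0 *m x s); exists B0.
  - apply: (filterS (Filter := ae_filter_ringOfSetsType _)) dx => u xu /andP[su ut].
    have u0 := le_trans s0 su.
    exists (a u *m x s); first by exists (a u) => //; exact: aA.
    exists (a u *m x u); first exact: xu.
    rewrite -mulmxBr (le_trans (AmL _ (aA u u0)))// -mulrA ler_wpM2l//.
    rewrite (le_trans (xK _ _ s0 su (le_trans ut tT)))// ler_wpM2l// lerB//.
have {}h n : {B | A B & `|x t - x s - (t - s) *: (B *m x s)| <=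
    L * K * (t - s) ^+ 2 + n.+1%:R^-1}.
  by apply: cid2; apply: h; rewrite invr_gt0.
have [U UU Uoo] := eventually_ultra.
have [B AB BB] : exists2 B, A B & s2val (h n) @[n --> U] --> B.
  by apply: compact_ultra_cvg Acomp _; apply: nearW => n; case: (h n).
exists B => //; rewrite scalemxAl.
have tsB : (t - s) *: s2val (h n) @[n --> U] --> (t - s) *: B.
  exact: cvgZ (cvg_cst _) BB.
apply: (sol_lim UU (a := fun=> x t) (b := fun=> x s) _ _ tsB) => //.
- exact: cvg_cst.
- exact: cvg_cst.
- rewrite -[X in _ --> X]addr0; apply: cvgD; first exact: cvg_cst.
  exact: cvg_invS Uoo.
- by apply: nearW => n; rewrite -scalemxAl; case: (h n).
Qed.

(** [law_of_inclusion] yields a law on each [[0, n]], possibly a different one for each n;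
    [law_sol_compact], applied to the constant sequence x, merges them into one law on the
    half-line. *)
Lemma trajectory_law_solution x : trajectory A x -> law_solution x.
Proof.
move=> trx; have [U UU Uoo] := eventually_ultra.
have h (n : nat) : {F | [/\ F 0 = 0, law_on A n%:R F & sol_on L n%:R F x]}.
  apply: cid; have n0 : 0 <= n%:R :> R by [].
  have [K K0 xK] := trajectory_lipschitz n0 trx.
  have xC := trajectory_inclusion n0 K0 trx xK.
  exact: (law_of_inclusion A0 Acomp Aconv AL AmL UU Uoo (mulr_ge0 L0 K0) K0 xK xC).
have [||T|F [y [F0 lawF soly] xy]] := law_sol_compact B0 Acomp AL AmL UU
  (Fn := fun n => sval (h n)) (xn := fun=> x) (c := `|x 0|).
- by move=> n; case: (svalP (h n)).
- exact: nearW.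
- apply: Uoo; near=> n; have [_ lawn soln] := svalP (h n).
  have Tn : T <= n%:R.
    near: n; exact: nbhs_infty_ger.
  by split; [exact: law_onW lawn|exact: sol_onW soln].
exists F; split => // T s t s0 st tT.
have E u : 0 <= u -> x u = y u.
  by move=> u0; apply: (cvg_unique (@norm_hausdorff _ _) _ (xy u u0)); exact: cvg_cst.
by rewrite !E ?(le_trans s0 st)//; exact: soly tT.
Unshelve. all: by end_near. Qed.


(** * Recovering a switching law from its primitive *)

Section law_solution_trajectory.
Variables (F : R -> 'M[R]_d) (x : R -> 'cV[R]_d).
Hypotheses (lawF : forall T, law_on A T F) (solx : forall T, sol_on L T F x).

Let M T := expR (L * T) * `|x 0|.

Lemma sol_bounded T t : 0 <= t -> t <= T -> `|x t| <= M T.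
Proof.
move=> t0 tT; have := sol_le AmL (@lawF T) (@solx T) (lexx 0) t0 tT.
rewrite subr0 => /le_trans; apply; rewrite ler_wpM2r// ler_expR.
by rewrite ler_wpM2l.
Qed.

Lemma sol_lipschitz T s t : 0 <= s -> s <= t -> t <= T ->
  `|x t - x s| <= L * expR (L * T) * M T * (t - s).
Proof.
move=> s0 st tT; rewrite (le_trans (sol_sub_le AmL (@lawF T) (@solx T) s0 st tT))//.
have ts0 : 0 <= t - s by rewrite subr_ge0.
rewrite [leRHS]mulrAC ler_pM ?sol_bounded ?(le_trans st)//.
  by rewrite subr_ge0 expR_ge1// mulr_ge0.
rewrite (le_trans (expR_sub1_le _))// mulrAC ler_wpM2r// ler_wpM2l//.
by rewrite ler_expR ler_wpM2l//; lra.
Qed.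

Lemma sol_abs_continuous T : abs_continuous_on 0 T x.
Proof.
move=> e e0; pose K := L * expR (L * T) * M T.
have K0 : 0 <= K by rewrite !mulr_ge0 ?expR_ge0.
exists (e / (K + 1)); first by rewrite divr_gt0 ?ltr_wpDl.
move=> n u v uv _; rewrite ltr_pdivlMr ?ltr_wpDl// => h.
apply: le_lt_trans h; rewrite mulr_suml; apply: ler_sum => i _.
have [u0 [uv' vT]] := uv i.
rewrite (le_trans (sol_lipschitz u0 uv' vT))// mulrC ler_wpM2l ?subr_ge0//.
by rewrite lerDl.
Qed.

(** Differentiating x needs increments of both signs. For t < s the two times exchange roles, and
    replacing [x t] by [x s] in the linear term costs [L * K * (t - s) ^+ 2]. *)
Lemma sol_quadratic T : exists2 C, 0 <= C & forall s t,
  0 <= s -> s <= T -> 0 <= t -> t <= T ->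
  `|x t - x s - (F t - F s) *m x s| <= C * (t - s) ^+ 2.
Proof.
pose K := L * expR (L * T) * M T.
have K0 : 0 <= K by rewrite !mulr_ge0 ?expR_ge0.
pose C := L ^+ 2 * expR (L * T) * M T.
have C0 : 0 <= C by rewrite !mulr_ge0 ?expR_ge0.
have fwd s t : 0 <= s -> s <= t -> t <= T ->
    `|x t - x s - (F t - F s) *m x s| <= C * (t - s) ^+ 2.
  move=> s0 st tT; have ts0 : 0 <= t - s by rewrite subr_ge0.
  rewrite (le_trans (solx s0 st tT))//.
  have tsT : t - s <= T by lra.
  have h1 := growth_quadratic A0 AL ts0 tsT.
  rewrite (le_trans (ler_pM (growth_ge0 _ _) _ h1 (sol_bounded s0 (le_trans st tT))))//.
  by rewrite mulrAC.
exists (C + L * K); first by rewrite addr_ge0// mulr_ge0.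
move=> s t s0 sT t0 tT; have [st|/ltW ts] := leP s t.
  rewrite (le_trans (fwd _ _ s0 st tT))// ler_wpM2r ?sqr_ge0// lerDl.
  by rewrite mulr_ge0.
have -> : x t - x s - (F t - F s) *m x s =
    - (x s - x t - (F s - F t) *m x t) + (F s - F t) *m (x s - x t).
  rewrite -(opprB (F s)) mulNmx mulmxBr; apply/colP => i; rewrite !mxE; ring.
rewrite (le_trans (ler_normD _ _))// normrN mulrDl lerD//.
  by rewrite -sqrrN opprB fwd.
have st0 : 0 <= s - t by rewrite subr_ge0.
rewrite (le_trans (law_mulmx_le AmL (@lawF T) _ t0 ts sT))//.
rewrite (le_trans (ler_wpM2l _ (sol_lipschitz t0 ts sT))) ?mulr_ge0//.
by rewrite -/K le_eqVlt; apply/orP; left; apply/eqP; ring.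
Qed.

(** F is extended by its value at 0 to negative times, so that its entries are Lipschitz on the
    whole line. *)
Let f i j (t : R) : R := F (Num.max t 0) i j.

Let max0 (t : R) : 0 <= t -> Num.max t 0 = t.
Proof. by move=> t0; apply/max_idPl. Qed.

Let f_lip i j s t : s <= t -> `|f i j t - f i j s| <= L * (t - s).
Proof.
move=> st; have st' : Num.max s 0 <= Num.max t 0 by rewrite ge_max !le_max st lexx !orbT.
have s0 : 0 <= Num.max s 0 by rewrite le_max lexx orbT.
have := law_norm_le AL (@lawF (Num.max t 0)) s0 st' (lexx _).
have := mx_norm_coord (F (Num.max t 0) - F (Num.max s 0)) i j.
rewrite !mxE /f => h1 h2; rewrite (le_trans h1)// (le_trans h2)// ler_wpM2l//.
have [] := leP t 0; have [] := leP s 0; lra.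
Qed.

Let f_cont i j : continuous (f i j : R -> R).
Proof.
apply: (@lipschitz_continuous _ R^o R^o _ L) => s t.
have [ts|/ltW st] := leP t s.
  by rewrite [in leRHS]ger0_norm ?subr_ge0//; exact: f_lip.
rewrite distrC [in leRHS]distrC [in leRHS]ger0_norm ?subr_ge0//.
exact: f_lip.
Qed.

Let derivable_off_null : exists Z : set (measurableTypeR R),
  [/\ measurable Z, lebesgue_measure Z = 0%E &
    forall t, ~ Z t -> t <> 0 /\ forall i j, derivable (f i j : R -> R) t 1].
Proof.
have h1 : {ae @lebesgue_measure R, forall t, forall ij : 'I_d * 'I_d,
    derivable (f ij.1 ij.2 : R -> R) t 1}.
  apply: (@filter_forall _ _ _ _ (ae_filter_ringOfSetsType _)) => -[i j].
  exact: (lipschitz_ae_derivable (C := L) (@f_lip i j)).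
have h0 : {ae @lebesgue_measure R, forall t : R, t <> 0}.
  exists [set 0]; split; [exact: measurable_set1|exact: lebesgue_measure_set1|].
  by move=> t /= /contrapT.
have [Z [mZ Z0 hZ]] := @filterI _ _ (ae_filter_ringOfSetsType _) _ _ h0 h1.
exists Z; split => // t Zt; have [t0 dt] : t <> 0 /\ forall ij : 'I_d * 'I_d,
    derivable (f ij.1 ij.2 : R -> R) t 1.
  by apply: contrapT => h; apply: Zt; apply: hZ.
by split => // i j; exact: dt (i, j).
Qed.

Let quotient n t : 'M[R]_d :=
  \matrix_(i, j) (n.+1%:R * (f i j (t + n.+1%:R^-1) - f i j t)).

Let quotient_cvg t i j : derivable (f i j : R -> R) t 1 ->
  quotient n t i j @[n --> \oo] --> 'D_1 (f i j : R -> R) t.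
Proof.
move=> df; apply/cvgrPdist_le => e e0.
have dff : is_derive t 1 (f i j : R -> R) ('D_1 (f i j : R -> R) t) by exact: DeriveDef.
have [r r0 h] := is_derive_approx dff e0.
have /cvgrPdist_lt/(_ _ r0) := @cvg_harmonic R; apply: filterS => n.
rewrite sub0r normrN => /h {}h; rewrite mxE.
have n0 : 0 < n.+1%:R :> R by [].
rewrite -(ler_pM2r (_ : 0 < `|n.+1%:R^-1 : R|)) ?normr_gt0 ?invr_neq0 ?gt_eqF//.
rewrite distrC -normrM; apply: le_trans h.
rewrite le_eqVlt; apply/orP; left; apply/eqP; congr (`|_|).
by rewrite /GRing.scale/=; field; rewrite gt_eqF.
Qed.

Let quotient_in n t : 0 <= t -> A (quotient n t).
Proof.
move=> t0; have n0 : 0 < n.+1%:R^-1 :> R by rewrite invr_gt0.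
have tn : t <= t + n.+1%:R^-1 by rewrite lerDl ltW.
have [B AB E] := lawF t0 tn (lexx _).
suff -> : quotient n t = B by [].
apply/matrixP => i j; have /matrixP/(_ i j) := E; rewrite !mxE /f.
rewrite !max0 ?(le_trans t0 tn)// => ->.
by rewrite (addrC t) addrK mulrA divff ?mul1r.
Qed.

(* The law is the derivative of F off a null set, hence a limit of difference
   quotients, which take values in A. *)
Lemma law_solution_has_law : exists2 a, switching_law A a &
  {ae @lebesgue_measure R, forall t : R, 0 <= t ->
      is_derive t (1 : R) x (a t *m x t)}.
Proof.
have [Z [mZ Z0 hZ]] := derivable_off_null.
(* On the null set the value [B0] keeps the law in A at every time. *)
pose a t := if t \in Z then B0 else \matrix_(i, j) 'D_1 (f i j : R -> R) t.
exists a; last first.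
  exists Z; split => // t /= ht; apply: contrapT => Zt; apply: ht => t0.
  have [tn0 dt] := hZ t Zt.
  have tgt0 : 0 < t by rewrite lt_neqAle t0 andbT eq_sym; apply/eqP.
  have [C C0 quad] := sol_quadratic (t + 1).
  have aE : a t = \matrix_(i, j) 'D_1 (f i j : R -> R) t by rewrite /a memNset.
  suff h : h^-1 *: (x (h *: 1 + t) - x t) @[h --> 0^'] --> a t *m x t.
    apply: DeriveDef; first by apply/cvg_ex; exists (a t *m x t).
    by apply: cvg_lim h; exact: norm_hausdorff.
  pose q h : 'M[R]_d := \matrix_(i, j) (h^-1 *: (f i j (h *: 1 + t) - f i j t)).
  have q1 : q h @[h --> 0^'] --> a t.
    rewrite aE; apply: cvg_mx_coord => i j; rewrite mxE.
    under eq_cvg do rewrite mxE.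
    by have := dt i j.
  have q2 : q h *m x t @[h --> 0^'] --> a t *m x t.
    by apply: cvg_mulmx q1 _; exact: cvg_cst.
  (* The difference quotient of x is [q h *m x t] plus a remainder of order h, by
     [sol_quadratic]. *)
  rewrite -[X in _ --> X]addr0.
  rewrite (_ : (fun h => _) = (fun h => q h *m x t +
    (h^-1 *: (x (h *: 1 + t) - x t) - q h *m x t))); last first.
    by apply/funext => h; rewrite [RHS]addrC subrK.
  apply: cvgD => //; apply/cvgr0Pnorm_le => e e0; near=> h.
  have h0 : h != 0 by near: h; exact: nbhs_dnbhs_neq.
  have h1 : `|h| < 1 by near: h; apply: dnbhs0_lt.
  have ht : `|h| < t by near: h; apply: dnbhs0_lt.
  have he : `|h| < e / (C + 1).
    by near: h; apply: dnbhs0_lt; rewrite divr_gt0 ?ltr_wpDl.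
  move: h1 ht; rewrite !ltr_norml => /andP[h1 h2] /andP[h3 h4].
  have qE : q h = h^-1 *: (F (h + t) - F t).
    apply/matrixP => i j; rewrite !mxE /f [h *: 1]mulr1.
    by rewrite !max0//; lra.
  rewrite qE -scalemxAl -scalerBr normrZ normfV [h *: 1]mulr1.
  rewrite ler_pdivrMl ?normr_gt0//.
  have := quad t (h + t) t0 ltac:(lra) ltac:(lra) ltac:(lra).
  move=> /le_trans; apply; rewrite addrK -[h ^+ 2]real_normK ?num_real//.
  rewrite expr2 mulrCA ler_wpM2l//.
  move: he; rewrite ltr_pdivlMr ?ltr_wpDl// => /ltW; apply: le_trans.
  by rewrite mulrC ler_wpM2l// lerDl.
split.
  move=> t t0; rewrite /a; have [//|] := boolP (t \in Z).
  rewrite notin_setE => /hZ[_ dt].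
  apply: (@closed_cvg _ _ \oo _ (fun n => quotient n t) (fun B => A B)) => //.
  - by apply: compact_closed => //; exact: norm_hausdorff.
  - by apply: nearW => n; exact: quotient_in.
  - by apply: cvg_mx_coord => i j; rewrite mxE; exact: quotient_cvg.
move=> i j.
have maij : measurable_fun [set: measurableTypeR R] (fun t => a t i j : measurableTypeR R).
  pose g n t := if t \in Z then B0 i j else
    n.+1%:R * (f i j (t + n.+1%:R^-1) - f i j t).
  apply: (@measurable_fun_cvg _ _ _ _ g) => [n|t _].
    apply: measurable_fun_ifT => //.
      apply: (measurable_fun_bool true); rewrite setTI.
      rewrite [X in measurable X](_ : _ = Z)//.
      by apply/seteqP; split => t; [exact: set_mem|exact: mem_set].
    apply: measurable_funM => //; apply: measurable_funB.
      apply: (@measurableT_comp _ _ _ _ _ _ (f i j)).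
        exact: continuous_measurable_fun.
      exact: measurable_funD.
    exact: continuous_measurable_fun.
  rewrite /g /a; have [tZ|] := boolP (t \in Z); first exact: cvg_cst.
  rewrite notin_setE => /hZ[_ dt]; rewrite mxE.
  rewrite (_ : (fun n => _) = (fun n => quotient n t i j)).
    exact: quotient_cvg.
  by apply/funext => n; rewrite mxE.
(* The entry is Borel measurable, and Borel sets are generators of the completed sigma-algebra, with
   empty negligible part. *)
move=> _ Y mY; apply: sub_sigma_algebra.
exists (`[0, +oo[ `&` (fun t => a t i j) @^-1` Y).
  by apply: measurableI => //; rewrite -[X in measurable X]setTI; exact: maij.
by exists set0; [exact: negligible_set0|rewrite setU0].
Unshelve. all: by end_near. Qed.

Lemma law_solution_trajectory : trajectory A x.
Proof. by split; [move=> T _; exact: sol_abs_continuous|exact: law_solution_has_law]. Qed.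

End law_solution_trajectory.
End bridge.

(** * Abstract linear systems *)

Section linear_maps.
Context {R : realType} {d : nat}.

Lemma linear_bound (W : normedModType R) (f : {linear 'cV[R]_d -> W}) :
  exists2 C, 0 <= C & forall v, `|f v| <= C * `|v|.
Proof.
exists (\sum_(i < d) `|f (delta_mx i 0)|); first exact: sumr_ge0.
move=> v; rewrite [v in f v]matrix_sum_delta linear_sum mulr_suml.
rewrite (le_trans (ler_norm_sum _ _ _))//; apply: ler_sum => i _.
by rewrite big_ord1 linearZ normrZ mulrC ler_wpM2l// mx_norm_coord.
Qed.

Lemma linear_cvg (W : normedModType R) (f : {linear 'cV[R]_d -> W})
    T (F : set_system T) {FF : Filter F} (u : T -> 'cV[R]_d) (l : 'cV[R]_d) :
  u @ F --> l -> f (u k) @[k --> F] --> f l.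
Proof.
move=> ul; apply: (continuous_cvg _ _ ul).
have [C C0 fC] := linear_bound f.
by apply: (@lipschitz_continuous _ _ _ f C) => x y; rewrite -linearB.
Qed.

Lemma vspace_cvg T (F : set_system T) {FF : ProperFilter F} (V : {vspace 'cV[R]_d})
    (u : T -> 'cV[R]_d) (l : 'cV[R]_d) :
  (\forall k \near F, u k \in V) -> u @ F --> l -> l \in V.
Proof.
move=> uV ul; suff -> : l = projv V l by exact: memv_proj.
apply: (cvg_unique (@norm_hausdorff _ _) ul).
have h : projv V (u k) @[k --> F] --> projv V l.
  exact: (@linear_cvg 'cV[R]_d (projv V)).
apply: cvg_trans h; apply: near_eq_cvg.
by apply: filterS uV => k /projv_id.
Qed.

(** A subspace inside P of maximal dimension contains every vector of P, since adding the line of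
    that vector keeps it inside P. *)
Lemma subspace_vspace (P : 'cV[R]_d -> Prop) : P 0 ->
  (forall a u v, P u -> P v -> P (a *: u + v)) ->
  exists W : {vspace 'cV[R]_d}, forall v, v \in W <-> P v.
Proof.
move=> P0 Plin.
pose Q n := `[< exists2 W : {vspace 'cV[R]_d}, (forall v, v \in W -> P v) & \dim W = n >].
have exQ : exists n, Q n.
  by exists (\dim (0%VS : {vspace 'cV[R]_d})); apply/asboolP; exists 0%VS => // v; rewrite memv0 => /eqP ->.
have boundQ n : Q n -> (n <= \dim (fullv : {vspace 'cV[R]_d}))%N.
  by move=> /asboolP[W _ <-]; apply: dimvS; exact: subvf.
case: (ex_maxnP exQ boundQ) => n /asboolP[W WP Wn] maxn.
exists W => v; split; first exact: WP.
move=> Pv; have : Q (\dim (W + <[v]>)%VS).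
  apply/asboolP; exists (W + <[v]>)%VS => // w /memv_addP[w1 w1W [w2 /vlineP[a ->] ->]].
  by rewrite addrC; apply: Plin => //; exact: WP.
move/maxn; rewrite -Wn => dimle.
have : (W == W + <[v]>)%VS by rewrite eqEdim addvSl.
by move/eqP ->; apply: (subvP (addvSr W <[v]>)); exact: memv_line.
Qed.

End linear_maps.

Section compact_sequences.
Context {R : realType} {d : nat}.
Variables (U : set_system nat) (UU : UltraFilter U) (Uoo : \oo `<=` U).

(** An arbitrary ultrafilter on M has a limit l, and points of M within [1 / n.+1] of l form a
    sequence converging to l along U; so closedness for sequences suffices. *)
Lemma bounded_seq_closed_compact (M : set 'cV[R]_d) (r : R) :
  (forall v, M v -> `|v| <= r) ->
  (forall (u : nat -> 'cV[R]_d) (l : 'cV[R]_d),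
     (forall n, M (u n)) -> u @ U --> l -> M l) ->
  compact M.
Proof.
move=> Mr Mcl; rewrite compact_ultra => F FU FM.
have [|l Fl] := @mx_ultra_cvg R _ F FU d 1 id r.
  by apply: filterS FM => v /Mr.
exists l; split => //.
have h (n : nat) : {v | M v & `|l - v| < n.+1%:R^-1}.
  apply: cid2.
  have /cvgrPdist_lt/(_ n.+1%:R^-1) := Fl; rewrite invr_gt0 => /(_ (ltr0Sn _ _)).
  by move=> /(filterI FM)/filter_ex[v [Mv lv]]; exists v.
apply: (Mcl (fun n => s2val (h n))); first by move=> n; case: (h n).
apply/cvgrPdist_lt => e e0.
have /cvgrPdist_lt/(_ _ e0) := cvg_invS (R := R) Uoo; apply: filterS => n.
by rewrite sub0r normrN ger0_norm//; apply: lt_trans; case: (h n).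
Qed.

End compact_sequences.

(* Only the values at nonnegative times of the elements of S are relevant. *)
Record linear_system {R : realType} {d : nat} (U : set_system nat)
    (S : set (R -> 'cV[R]_d)) : Prop := LinearSystem {
  sys_shift : forall x s, 0 <= s -> S x -> S (fun t => x (s + t)) ;
  sys_cat : forall x y s, 0 <= s -> S x -> S y -> y 0 = x s ->
    exists2 z, S z & (forall t, 0 <= t -> t <= s -> z t = x t) /\
      (forall t, 0 <= t -> z (s + t) = y t) ;
  sys_scale : forall x (c : R), S x -> S (fun t => c *: x t) ;
  sys_split : forall x v w, S x -> x 0 = v + w -> exists y z,
    [/\ S y, S z, y 0 = v, z 0 = w & forall t, 0 <= t -> x t = y t + z t] ;
  sys_exists : forall v, exists2 x, S x & x 0 = v ;
  sys_bound : forall T, exists2 C, 1 <= C &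
    forall x t, S x -> 0 <= t -> t <= T -> `|x t| <= C * `|x 0| ;
  sys_compact : forall (xn : nat -> R -> 'cV[R]_d) c,
    (\forall n \near U, S (xn n)) -> (\forall n \near U, `|xn n 0| <= c) ->
    exists2 x, S x & forall t, 0 <= t -> xn n t @[n --> U] --> x t }.

Section linear_system_theory.
Context {R : realType} {d : nat}.
Variables (U : set_system nat) (UU : UltraFilter U) (Uoo : \oo `<=` U).

(** These are the paths [expR (- (c * t)) *: y t] with y in S: all exponential rates drop by c. *)
Definition rescale (c : R) (S : set (R -> 'cV[R]_d)) : set (R -> 'cV[R]_d) :=
  [set x | S (fun t => expR (c * t) *: x t)].

Lemma expR_scaleK (c : R) (v : 'cV[R]_d) : expR c *: (expR (- c) *: v) = v.
Proof. by rewrite scalerA -expRD subrr expR0 scale1r. Qed.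

Lemma rescaleP c S x : S x -> rescale c S (fun t => expR (- (c * t)) *: x t).
Proof.
move=> Sx; rewrite /rescale/=.
by rewrite (_ : (fun t => _) = x)//; apply/funext => t; rewrite expR_scaleK.
Qed.

Lemma rescale_system c S : linear_system U S -> linear_system U (rescale c S).
Proof.
move=> sysS; split.
- move=> x s s0 Sx; rewrite /rescale/=.
  have := sys_scale sysS (expR (- (c * s))) (sys_shift sysS s0 Sx).
  congr S; apply/funext => t /=; rewrite scalerA -expRD mulrDr addrA addNr.
  by rewrite add0r.
- move=> x y s s0 Sx Sy yx.
  have Sy' := sys_scale sysS (expR (c * s)) Sy.
  have [|z Sz [zx zy]] := sys_cat sysS s0 Sx Sy'.
    by rewrite mulr0 expR0 scale1r yx.
  exists (fun t => expR (- (c * t)) *: z t); first exact: rescaleP.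
  split => t t0 => [ts|].
    by rewrite zx// scalerA -expRD addNr expR0 scale1r.
  rewrite zy// !scalerA -!expRD [X in expR X](_ : _ = 0) ?expR0 ?scale1r//.
  ring.
- move=> x a Sx; rewrite /rescale/=.
  have := sys_scale sysS a Sx; congr S; apply/funext => t.
  by rewrite !scalerA mulrC.
- move=> x v w Sx xvw.
  have [|y [z [Sy Sz yv zw xyz]]] := sys_split (v := v) (w := w) sysS Sx.
    by rewrite mulr0 expR0 scale1r.
  exists (fun t => expR (- (c * t)) *: y t), (fun t => expR (- (c * t)) *: z t).
  split; [exact: rescaleP|exact: rescaleP| | |].
  + by rewrite mulr0 oppr0 expR0 scale1r.
  + by rewrite mulr0 oppr0 expR0 scale1r.
  + move=> t t0; rewrite -scalerDr -xyz//.
    by rewrite scalerA -expRD addNr expR0 scale1r.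
- move=> v; have [x Sx xv] := sys_exists sysS v.
  exists (fun t => expR (- (c * t)) *: x t); first exact: rescaleP.
  by rewrite mulr0 oppr0 expR0 scale1r.
- move=> T; have [C C1 SC] := sys_bound sysS T.
  exists (C * expR (`|c| * `|T|)).
    by rewrite mulr_ege1// expR_ge1// mulr_ge0.
  move=> x t Sx t0 tT; have := SC _ t Sx t0 tT.
  rewrite mulr0 expR0 scale1r normrZ (ger0_norm (expR_ge0 _)) => h.
  have -> : `|x t| = expR (- (c * t)) * (expR (c * t) * `|x t|).
    by rewrite mulrA -expRD addNr expR0 mul1r.
  rewrite [leRHS]mulrAC [leRHS]mulrC ler_pM ?mulr_ge0 ?expR_ge0//.
  rewrite ler_expR -mulNr (le_trans (ler_norm _))// normrM normrN ler_wpM2l//.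
  by rewrite ger0_norm// (le_trans tT)// ler_norm.
- move=> xn r Sn xnr.
  have [|x Sx xnx] := sys_compact sysS (c := r) Sn.
    by apply: filterS xnr => n; rewrite mulr0 expR0 scale1r.
  exists (fun t => expR (- (c * t)) *: x t); first exact: rescaleP.
  move=> t t0; rewrite (_ : (fun n => xn n t) =
    (fun n => expR (- (c * t)) *: (expR (c * t) *: xn n t))).
    by apply: cvgZ; [exact: cvg_cst|exact: xnx].
  by apply/funext => n; rewrite scalerA -expRD addNr expR0 scale1r.
Qed.

Section one_system.
Variable S : set (R -> 'cV[R]_d).
Hypothesis sysS : linear_system U S.

Definition flow_invariant (V : {vspace 'cV[R]_d}) :=
  forall x, S x -> x 0 \in V -> forall t, 0 <= t -> x t \in V.

Definition stable_on (V : {vspace 'cV[R]_d}) := exists C, exists2 l, 0 < l &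
  forall x, S x -> x 0 \in V -> forall t, 0 <= t ->
    `|x t| <= C * expR (- (l * t)) * `|x 0|.

Lemma sys_eq0 x t : S x -> x 0 = 0 -> 0 <= t -> x t = 0.
Proof.
move=> Sx x0 t0; have [C _ SC] := sys_bound sysS t.
have := SC _ _ Sx t0 (lexx t); rewrite x0 normr0 mulr0 normr_le0.
by move/eqP.
Qed.

(** Compactness over the unit sphere of V: trajectories with ever later halving times would have a
    limit that never falls below one half at an integer time. *)
Lemma uniform_halving (V : {vspace 'cV[R]_d}) :
  (forall x, S x -> x 0 \in V -> x 0 != 0 -> exists k : nat, `|x k%:R| < `|x 0| / 2) ->
  exists2 n : nat, (0 < n)%N & forall x, S x -> x 0 \in V -> x 0 != 0 ->
    exists2 k, (0 < k <= n)%N & `|x k%:R| <= `|x 0| / 2.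
Proof.
move=> half.
have [n nP] : exists n : nat, forall x, S x -> x 0 \in V -> `|x 0| = 1 ->
    exists2 k, (k <= n)%N & `|x k%:R| <= 2^-1.
  apply: contrapT => /forallNP h.
  have {}h n : {x | [/\ S x, x 0 \in V & `|x 0| = 1] &
      forall k, (k <= n)%N -> 2^-1 < `|x k%:R|}.
    apply: cid2; move/existsNP : (h n) => [x /not_implyP[Sx]].
    move=> /not_implyP[xV] /not_implyP[x1] /forall2NP xk; exists x => // k kn.
    by rewrite ltNge; apply/negP; case: (xk k).
  have [||x Sx xnx] := sys_compact sysS (xn := fun n => s2val (h n)) (c := 1).
  - by apply: nearW => n; case: (h n) => ? [].
  - by apply: nearW => n; case: (h n) => ? [_ _] /= ->.
  have xV : x 0 \in V.
    apply: vspace_cvg (xnx 0 (lexx 0)); apply: nearW => n.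
    by case: (h n) => ? [].
  have x1 : `|x 0| = 1.
    apply: (@cvg_unique R^o (@norm_hausdorff _ _) _ _ _ _ (cvg_norm (xnx 0 (lexx 0)))).
    rewrite (_ : (fun n => _) = fun=> 1); first exact: cvg_cst.
    by apply/funext => n; case: (h n) => ? [].
  have [|k] := half x Sx xV; first by rewrite -normr_gt0 x1.
  rewrite x1 mul1r ltNge => /negP; apply.
  apply: (cvgr_to_ge (cvg_norm (xnx k%:R (ler0n R k)))).
  apply: Uoo; near=> n; apply/ltW.
  have kn : (k <= n)%N by near: n; exact: nbhs_infty_ge.
  by case: (h n) => ? _ /= /(_ k kn).
(* Time 0 is excluded because [x 0] is not zero; the successor makes the bound on k positive. *)
exists n.+1 => // x Sx xV xn0.
have x0 : 0 < `|x 0| by rewrite normr_gt0.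
have [||k kn] := nP (fun t => `|x 0|^-1 *: x t) (sys_scale sysS _ Sx).
- by rewrite memvZ.
- by rewrite normrZ ger0_norm ?invr_ge0// mulVf// gt_eqF.
rewrite normrZ ger0_norm ?invr_ge0// ler_pdivrMl// => xk.
exists k => //; rewrite (leq_trans kn)// andbT lt0n; apply/eqP => k0.
by move: xk; rewrite k0 mulr0n; lra.
Unshelve. all: by end_near. Qed.

(** Halvings at delays of at most n can be repeated, as V is invariant, whence the rate [ln 2 / n].
    G covers the times up to n, and the factor 2 compensates the exponential there. *)
Lemma stable_onP (V : {vspace 'cV[R]_d}) : flow_invariant V ->
  (forall x, S x -> x 0 \in V -> x 0 != 0 -> exists k : nat, `|x k%:R| < `|x 0| / 2) ->
  stable_on V.
Proof.
move=> invV /uniform_halving[n n0 half].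
have [G G1 SG] := sys_bound sysS n%:R.
have G0 : 0 <= G by lra.
have [l l0 ln2] : exists2 l : R, 0 < l & expR (l * n%:R) = 2.
  exists (ln 2 / n%:R); first by rewrite divr_gt0 ?ln_gt0 ?ltr0n// ltr1n.
  by rewrite divfK ?lnK ?posrE// pnatr_eq0 -lt0n.
exists (2 * G); exists l => //.
have claim m : forall x, S x -> x 0 \in V -> forall t, 0 <= t -> t < m%:R ->
    `|x t| <= 2 * G * expR (- (l * t)) * `|x 0|.
  elim: m => [|m ih] x Sx xV t t0 tm; first by rewrite ltNge t0 in tm.
  have [x0|xn0] := eqVneq (x 0) 0.
    by rewrite (sys_eq0 Sx x0 t0) x0 normr0 mulr0.
  have [tn|nt] := leP t n%:R.
    rewrite (le_trans (SG _ _ Sx t0 tn))// ler_wpM2r//.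
    rewrite mulrAC ler_peMl// expRN -ler_pdivrMr ?invr_gt0 ?expR_gt0//.
    by rewrite invrK mul1r -ln2 ler_expR ler_pM2l.
  have [k /andP[k0 kn] xk] := half x Sx xV xn0.
  have kt : k%:R <= t by rewrite (le_trans _ (ltW nt))// ler_nat.
  have kR1 : 1 <= k%:R :> R by rewrite ler1n.
  have := ih _ (sys_shift sysS (ler0n R k) Sx) _ (t - k%:R).
  rewrite addr0 => /(_ _ _ _).
  have tk0 : 0 <= t - k%:R by rewrite subr_ge0.
  have tkm : t - k%:R < m%:R by move: tm; rewrite -natr1; lra.
  move=> /(_ (invV _ Sx xV _ (ler0n R k)) tk0 tkm).
  rewrite addrC subrK => /le_trans; apply.
  rewrite -!mulrA ler_wpM2l// ler_wpM2l//.
  rewrite (le_trans (ler_wpM2l _ xk)) ?expR_ge0// mulrA mulrAC ler_wpM2r//.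
  rewrite ler_pdivrMr// mulrBr opprB addrC expRD ler_wpM2l ?expR_ge0//.
  by rewrite -ln2 ler_expR ler_pM2l// ler_nat.
move=> x Sx xV t t0; apply: (claim (Num.truncn t).+1) => //.
by have /andP[] := truncn_itv t0.
Qed.

End one_system.

Lemma expR_small (C l e : R) : 0 < l -> 0 < e ->
  exists k : nat, C * expR (- (l * k%:R)) < e.
Proof.
move=> l0 e0; pose k := (Num.truncn (`|C| / (e * l))).+1.
exists k.
have el0 : 0 < e * l by rewrite mulr_gt0.
have /andP[_] := truncn_itv (divr_ge0 (normr_ge0 C) (ltW el0)).
rewrite -/k ltr_pdivrMr// => h.
rewrite expRN ltr_pdivrMr ?expR_gt0//.
have := expR_ge1Dx (l * k%:R); rewrite -(ler_pM2l e0).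
by have := ler_norm C; lra.
Qed.

Definition rate_le (c : R) (x : R -> 'cV[R]_d) :=
  exists C, forall t, 0 <= t -> `|x t| <= C * expR (c * t).

Definition sys_eigenset (S : set (R -> 'cV[R]_d)) (M : set 'cV[R]_d) (alpha : R) :=
  [/\ compact M, M !=set0, M <> [set 0] &
    forall t : R, 0 <= t ->
      [set x t | x in [set x | S x /\ M (x 0)]] =
      [set expR (alpha * t) *: v | v in M]].

(** * Exponential rates, eigensets and dimensions *)

Section rates.
Variable S : set (R -> 'cV[R]_d).
Hypothesis sysS : linear_system U S.

Lemma rate_le_halving (c : R) x (e : R) : rate_le c x -> c < 0 -> 0 < e ->
  exists k : nat, `|x k%:R| < e.
Proof.
move=> [C xC] c0 e0; have nc0 : 0 < - c by rewrite oppr_gt0.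
have [k kC] := expR_small C nc0 e0.
exists k; rewrite (le_lt_trans (xC _ (ler0n R k)))//.
by rewrite mulNr opprK in kC.
Qed.

(** Multiplied by [expR (- (b * t))], the trajectories in V have the negative rate [c - b], hence
    get halved, and [stable_onP] gives a common constant. *)
Lemma uniform_rate (V : {vspace 'cV[R]_d}) (c b : R) : c < b -> flow_invariant S V ->
  (forall x, S x -> x 0 \in V -> rate_le c x) ->
  exists2 C, 0 <= C & forall x, S x -> x 0 \in V -> forall t, 0 <= t ->
    `|x t| <= C * expR (b * t) * `|x 0|.
Proof.
move=> cb invV rV; have sysb := rescale_system b sysS.
have [||C [l l0 SC]] := stable_onP (V := V) sysb.
- move=> x Sx xV t t0; have := invV _ Sx; rewrite mulr0 expR0 scale1r.
  move=> /(_ xV t t0) /(memvZ (expR (- (b * t)))).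
  by rewrite scalerA -expRD addNr expR0 scale1r.
- move=> x Sx xV xn0.
  have [|C xC] := rV _ Sx; first by rewrite mulr0 expR0 scale1r.
  apply: (@rate_le_halving (c - b)); last by rewrite divr_gt0 ?normr_gt0.
    exists C => t t0; have := xC t t0; rewrite normrZ (ger0_norm (expR_ge0 _)).
    rewrite mulrBl expRD expRN mulrA ler_pdivlMr ?expR_gt0//.
    by rewrite mulrC.
  by rewrite subr_lt0.
exists `|C| => // x Sx xV t t0.
have := SC _ (rescaleP b Sx); rewrite mulr0 oppr0 expR0 scale1r => /(_ xV t t0).
rewrite normrZ (ger0_norm (expR_ge0 _)) expRN -ler_pdivlMl ?invr_gt0 ?expR_gt0//.
rewrite invrK => /le_trans; apply.
rewrite !mulrA ler_wpM2r// -mulrA mulrC ler_wpM2r ?expR_ge0//.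
rewrite (le_trans (ler_wpM2r _ (ler_norm C))) ?expR_ge0//.
by rewrite ler_piMr// -expR0 ler_expR oppr_le0 mulr_ge0// ltW.
Qed.

(** [sys_split] makes these vectors a subspace. It is invariant because any trajectory issued from
    [x s] prolongs x, and the delay s only changes the constant. *)
Lemma rate_space (c : R) : exists2 W : {vspace 'cV[R]_d}, flow_invariant S W &
  forall v, v \in W <-> forall x, S x -> x 0 = v -> rate_le c x.
Proof.
have [||W WP] := @subspace_vspace R d (fun v => forall x, S x -> x 0 = v -> rate_le c x).
- by move=> x Sx x0; exists 0 => t t0; rewrite (sys_eq0 sysS Sx x0 t0) normr0 mul0r.
- move=> a u v Pu Pv x Sx xuv.
  have [y [z [Sy Sz yu zv xyz]]] := sys_split sysS Sx xuv.
  have [z' Sz' z'u] := sys_exists sysS u.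
  have [C2 zC] := Pv _ Sz zv.
  have [a0|an0] := eqVneq a 0.
    exists C2 => t t0; rewrite xyz// (sys_eq0 sysS Sy _ t0) ?add0r ?zC//.
    by rewrite yu a0 scale0r.
  have [|C1 yC] := Pu _ (sys_scale sysS a^-1 Sy).
    by rewrite yu scalerA mulVf// scale1r.
  exists (`|a| * C1 + C2) => t t0; rewrite xyz// (le_trans (ler_normD _ _))//.
  rewrite mulrDl lerD ?zC// -mulrA -ler_pdivrMl ?normr_gt0//.
  by rewrite -normfV -normrZ yC.
exists W => // x Sx /WP xW s s0; apply/WP => y Sy yx.
have [z Sz [zx zy]] := sys_cat sysS s0 Sx Sy yx.
have [|C zC] := xW z Sz; first by rewrite zx.
exists (C * expR (c * s)) => t t0; rewrite -zy// -mulrA -expRD -mulrDr zC//.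
by rewrite addr_ge0.
Qed.

Lemma eigenset_neq0 M alpha : sys_eigenset S M alpha -> exists2 v, M v & v != 0.
Proof.
move=> [_ [w Mw] Mn0 _]; apply: contrapT => h; apply: Mn0.
have M0 v : M v -> v = 0.
  by move=> Mv; apply: contrapT => /eqP v0; apply: h; exists v.
by apply/seteqP; split => v /=; [exact: M0|move=> ->; rewrite -(M0 _ Mw)].
Qed.

Lemma eigenset_bounded M alpha : sys_eigenset S M alpha ->
  exists2 r, 0 <= r & forall v, M v -> `|v| <= r.
Proof.
move=> [/compact_bounded[r [_ Mr]] _ _ _]; exists (`|r| + 1); first exact: addr_ge0.
by move=> v Mv; apply: Mr => //; rewrite (le_lt_trans (ler_norm r))// ltrDl.
Qed.

Lemma eigenset_rate M alpha : sys_eigenset S M alpha ->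
  forall x, S x -> M (x 0) -> rate_le alpha x.
Proof.
move=> eM x Sx Mx; have [r r0 Mr] := eigenset_bounded eM.
have [_ _ _ Mt] := eM; exists r => t t0.
have [v Mv <-] : [set expR (alpha * t) *: v | v in M] (x t).
  by rewrite -Mt//; exists x.
by rewrite normrZ (ger0_norm (expR_ge0 _)) mulrC ler_wpM2r ?expR_ge0// Mr.
Qed.

(** If c < alpha, an intermediate rate b bounds the points reached from M by a multiple of
    [expR (b * t)], whereas they include [expR (alpha * t) *: v] for a nonzero v in M. *)
Lemma eigenvalue_le_rate M alpha (V : {vspace 'cV[R]_d}) (c : R) :
  sys_eigenset S M alpha -> flow_invariant S V -> (forall v, M v -> v \in V) ->
  (forall x, S x -> x 0 \in V -> rate_le c x) -> alpha <= c.
Proof.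
move=> eM invV MV rV; rewrite leNgt; apply/negP => ca.
have [v Mv vn0] := eigenset_neq0 eM; have [r r0 Mr] := eigenset_bounded eM.
pose b := (c + alpha) / 2.
have cb : c < b by rewrite /b; lra.
have [C C0 SC] := uniform_rate cb invV rV.
have ab : 0 < alpha - b by rewrite /b; lra.
have v0 : 0 < `|v| by rewrite normr_gt0.
have [k] := expR_small (C * r) ab v0; rewrite ltNge => /negP; apply.
have [_ _ _ Mt] := eM; have k0 := ler0n R k.
have [x [Sx Mx] xk] : [set x k%:R | x in [set x | S x /\ M (x 0)]]
  (expR (alpha * k%:R) *: v) by rewrite Mt//; exists v.
have := SC x Sx (MV _ Mx) _ k0; rewrite xk normrZ (ger0_norm (expR_ge0 _)).
have -> : - ((alpha - b) * k%:R) = b * k%:R - alpha * k%:R by ring.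
rewrite expRD expRN mulrA ler_pdivlMr ?expR_gt0// mulrC => /le_trans; apply.
by rewrite mulrAC ler_wpM2r ?expR_ge0// ler_wpM2l// Mr.
Qed.

(** D gives the dimension of the space of [rate_space]. Equal dimensions for alpha < beta would put
    an eigenset for beta inside [W alpha], against [eigenvalue_le_rate]. *)
Lemma eigenvalues_dim : exists D : R -> nat,
  (forall M alpha, sys_eigenset S M alpha -> (0 < D alpha <= d)%N) /\
  (forall M alpha N beta, sys_eigenset S M alpha -> sys_eigenset S N beta ->
    alpha < beta -> (D alpha < D beta)%N).
Proof.
pose W c := s2val (cid2 (rate_space c)).
have invW c : flow_invariant S (W c) := s2valP (cid2 (rate_space c)).
have WP c : forall v, v \in W c <-> forall x, S x -> x 0 = v -> rate_le c x :=
  s2valP' (cid2 (rate_space c)).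
have MW M alpha : sys_eigenset S M alpha -> forall v, M v -> v \in W alpha.
  move=> eM v Mv; apply/WP => x Sx xv; apply: (eigenset_rate eM) => //.
  by rewrite xv.
exists (fun c => \dim (W c)); split => [M alpha eM|M alpha N beta eM eN ab].
  have [v Mv vn0] := eigenset_neq0 eM; apply/andP; split.
    rewrite lt0n dimv_eq0; apply: contra vn0 => /eqP W0.
    by have := MW _ _ eM v Mv; rewrite W0 memv0.
  rewrite (leq_trans (dimvS (subvf _)))// dimvf.
  by rewrite dim_matrix mulr1.
have sW : (W alpha <= W beta)%VS.
  apply/subvP => v /WP vW; apply/WP => x Sx xv; have [C xC] := vW x Sx xv.
  exists `|C| => t t0; rewrite (le_trans (xC t t0))//.
  rewrite (le_trans (ler_wpM2r _ (ler_norm C))) ?expR_ge0//.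
  by rewrite ler_wpM2l// ler_expR ler_wpM2r// ltW.
rewrite ltn_neqAle dimvS// andbT; apply/negP => dimE.
have /eqP WE : W alpha == W beta by rewrite eqEdim sW /= (eqP dimE).
suff : beta <= alpha by rewrite leNgt ab.
apply: (eigenvalue_le_rate eN (invW alpha)); first by rewrite WE; exact: MW.
by move=> x Sx /WP; apply.
Qed.

End rates.
End linear_system_theory.

(** * Existence of an eigenset for the exponent 0 *)

Section eigenset_existence.
Context {R : realType} {d : nat}.
Variables (U : set_system nat) (UU : UltraFilter U) (Uoo : \oo `<=` U).
Variable S : set (R -> 'cV[R]_d).
Hypothesis sysS : linear_system U S.
Hypothesis subexp : forall b x, 0 < b -> S x -> rate_le b x.

Lemma minimal_unstable : ~ stable_on S fullv ->
  exists V : {vspace 'cV[R]_d}, [/\ flow_invariant S V, ~ stable_on S V &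
    forall W : {vspace 'cV[R]_d}, flow_invariant S W -> (\dim W < \dim V)%N ->
      stable_on S W].
Proof.
move=> nst; pose Q n := `[< exists V : {vspace 'cV[R]_d},
  [/\ flow_invariant S V, ~ stable_on S V & \dim V = n] >].
have exQ : exists n, Q n.
  exists (\dim (fullv : {vspace 'cV[R]_d})); apply/asboolP; exists fullv.
  by split => // x _ _ t _; exact: memvf.
case: (ex_minnP exQ) => n /asboolP[V [invV nsV Vn]] minn.
exists V; split => // W invW WV; apply: contrapT => nsW.
have : Q (\dim W) by apply/asboolP; exists W.
by move/minn; rewrite -Vn leqNgt WV.
Qed.

Lemma flow_invariantT : flow_invariant S fullv.
Proof. by move=> x _ _ t _; exact: memvf. Qed.

(** * Discounted amplitudes of trajectories *)

Section amplitude.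
Variable b : R.
Hypothesis b0 : 0 < b.

Let values (v : 'cV[R]_d) : set R := [set r | exists x t,
  [/\ S x, x 0 = v, 0 <= t & r = expR (- (b * t)) * `|x t| ] ].

Definition amplitude v := sup (values v).

(** All trajectories have rate [b / 2], hence rate b with a uniform constant. *)
Let values_bound : exists2 C, 0 <= C & forall v, ubound (values v) (C * `|v|).
Proof.
have b20 : 0 < b / 2 by rewrite divr_gt0.
have b2b : b / 2 < b by lra.
have [C C0 SC] := uniform_rate UU Uoo sysS (V := fullv) b2b flow_invariantT
  (fun x Sx _ => subexp b20 Sx).
exists C => // v _ [x [t [Sx <- t0 ->]]].
have := SC x Sx (memvf _) t t0.
by rewrite expRN -ler_pdivlMl ?invr_gt0 ?expR_gt0// invrK mulrCA mulrA.
Qed.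

Let has_sup_values v : has_sup (values v).
Proof.
split; last by have [C _ h] := values_bound; exists (C * `|v|); exact: h.
have [x Sx xv] := sys_exists sysS v.
by exists (expR (- (b * 0)) * `|x 0|), x, 0.
Qed.

Lemma amplitude_ge x t : S x -> 0 <= t ->
  expR (- (b * t)) * `|x t| <= amplitude (x 0).
Proof.
move=> Sx t0; apply: (sup_upper_bound (has_sup_values _)).
by exists x, t.
Qed.

Lemma amplitude_le v M : (forall x t, S x -> x 0 = v -> 0 <= t ->
  expR (- (b * t)) * `|x t| <= M) -> amplitude v <= M.
Proof.
move=> vM; apply: ge_sup; first by have [] := has_sup_values v.
by move=> _ [x [t [Sx xv t0 ->]]]; exact: vM.
Qed.

Lemma norm_le_amplitude v : `|v| <= amplitude v.
Proof.
have [x Sx <-] := sys_exists sysS v.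
by have := amplitude_ge Sx (lexx 0); rewrite mulr0 oppr0 expR0 mul1r.
Qed.

Lemma amplitude_ge0 v : 0 <= amplitude v.
Proof. exact: le_trans (norm_le_amplitude v). Qed.

Lemma amplitudeD v w : amplitude (v + w) <= amplitude v + amplitude w.
Proof.
apply: amplitude_le => x t Sx xvw t0.
have [y [z [Sy Sz <- <- ->//]]] := sys_split sysS Sx xvw.
rewrite (le_trans (ler_wpM2l (expR_ge0 _) (ler_normD _ _)))// mulrDr.
by rewrite lerD ?amplitude_ge.
Qed.

Lemma amplitudeZ a v : amplitude (a *: v) <= `|a| * amplitude v.
Proof.
have [->|an0] := eqVneq a 0.
  rewrite normr0 mul0r; apply: amplitude_le => x t Sx; rewrite scale0r => x0 t0.
  by rewrite (sys_eq0 sysS Sx x0 t0) normr0 mulr0.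
apply: amplitude_le => x t Sx xv t0.
have := amplitude_ge (sys_scale sysS a^-1 Sx) t0.
rewrite xv scalerA mulVf// scale1r normrZ normfV mulrCA.
by rewrite ler_pdivrMl ?normr_gt0.
Qed.

(** A trajectory issued from [x s] prolongs x, and the delay s accounts for the factor
    [expR (b * s)]. *)
Lemma amplitude_flow x s : S x -> 0 <= s ->
  amplitude (x s) <= expR (b * s) * amplitude (x 0).
Proof.
move=> Sx s0; apply: amplitude_le => y t Sy yx t0.
have [z Sz [zx zy]] := sys_cat sysS s0 Sx Sy yx.
have := amplitude_ge Sz (addr_ge0 s0 t0); rewrite (zx 0)// zy//.
rewrite mulrDr opprD expRD -mulrA (expRN (b * s)) => h.
rewrite -(ler_pM2l (_ : 0 < (expR (b * s))^-1)) ?invr_gt0 ?expR_gt0//.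
by rewrite mulKf ?gt_eqF ?expR_gt0.
Qed.

End amplitude.

(** * Boundedness in a minimal unstable subspace *)

Section minimal_space.
Variable V : {vspace 'cV[R]_d}.
Hypothesis invV : flow_invariant S V.
Hypothesis unstableV : ~ stable_on S V.
Hypothesis minV : forall W : {vspace 'cV[R]_d}, flow_invariant S W ->
  (\dim W < \dim V)%N -> stable_on S W.

Let rate n : R := n.+1%:R^-1.
Let rate0 n : 0 < rate n. Proof. by rewrite invr_gt0. Qed.

Let basis i := (vbasis V)`_i.
(** Normalizing by the sum over a basis keeps the limit as n grows both finite on V and nonzero. *)
Let total n := \sum_(i < \dim V) amplitude (rate n) (basis i).

Let dimV_gt0 : (0 < \dim V)%N.
Proof.
rewrite lt0n dimv_eq0; apply/negP => /eqP V0; apply: unstableV.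
exists 0, 1 => // x Sx; rewrite V0 memv0 => /eqP x0 t t0.
by rewrite (sys_eq0 sysS Sx x0 t0) normr0 !mul0r.
Qed.

Let total_gt0 n : 0 < total n.
Proof.
have ge0 i : 0 <= amplitude (rate n) (basis i) by apply: amplitude_ge0.
rewrite lt_neqAle sumr_ge0// andbT eq_sym psumr_eq0//.
apply/negP => /allP/(_ (Ordinal dimV_gt0) (mem_index_enum _))/= /eqP amp0.
have := norm_le_amplitude (rate0 n) (basis 0); rewrite amp0 normr_le0.
apply/negP; apply: (free_not0 (basis_free (vbasisP V))).
by apply: mem_nth; rewrite size_tuple.
Qed.

Let gn n v := amplitude (rate n) v / total n.

Let gn_ge0 n v : 0 <= gn n v.
Proof. by rewrite divr_ge0 ?amplitude_ge0// ltW. Qed.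

Let gnD n v w : gn n (v + w) <= gn n v + gn n w.
Proof. by rewrite -mulrDl ler_pM2r ?invr_gt0// amplitudeD. Qed.

Let gnZ n a v : gn n (a *: v) <= `|a| * gn n v.
Proof. by rewrite mulrA ler_pM2r ?invr_gt0// amplitudeZ. Qed.

Let gn_sum n (I : finType) (v : I -> 'cV[R]_d) :
  gn n (\sum_i v i) <= \sum_i gn n (v i).
Proof.
elim/big_ind2 : _ => // [|x y x' y' h h'].
  by have := gnZ n 0 0; rewrite scale0r normr0 mul0r.
by rewrite (le_trans (gnD _ _ _))// lerD.
Qed.

Let gn_bound n v : v \in V -> gn n v <= \sum_(i < \dim V) `|coord (vbasis V) i v|.
Proof.
move=> vV; rewrite [v in gn n v](coord_vbasis vV).
rewrite (le_trans (gn_sum _ _))//; apply: ler_sum => i _.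
rewrite (le_trans (gnZ _ _ _))// ler_piMr//.
rewrite ler_pdivrMr// mul1r /total (bigD1 i)//= lerDl sumr_ge0// => j _.
exact: amplitude_ge0.
Qed.

Let seminorm_ex v : {l | v \in V -> gn n v @[n --> U] --> (l : R)}.
Proof.
apply: cid; have [vV|] := boolP (v \in V); last by exists 0.
have [|l _] := compact_ultra_cvg (U := U) (u := gn ^~ v)
  (@segment_compact R 0 (\sum_(i < \dim V) `|coord (vbasis V) i v|)); last by exists l.
by apply: nearW => n /=; rewrite in_itv/= gn_ge0 gn_bound.
Qed.

Let g v := sval (seminorm_ex v).
Let g_cvg v : v \in V -> gn n v @[n --> U] --> g v := svalP (seminorm_ex v).

Let g_ge0 v : v \in V -> 0 <= g v.
Proof. by move=> vV; apply: cvgr_to_ge (g_cvg vV) _; apply: nearW => n. Qed.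

Let gD v w : v \in V -> w \in V -> g (v + w) <= g v + g w.
Proof.
move=> vV wV; apply: (ler_cvg_to (g_cvg (memvD vV wV)) (cvgD (g_cvg vV) (g_cvg wV))).
by apply: nearW => n; exact: gnD.
Qed.

Let gZ a v : v \in V -> g (a *: v) <= `|a| * g v.
Proof.
move=> vV; apply: (ler_cvg_to (g_cvg (memvZ a vV)) (cvgMl_tmp (g_cvg vV))).
by apply: nearW => n; exact: gnZ.
Qed.

(** The factor [expR (rate n * s)] of [amplitude_flow] tends to 1. *)
Let g_flow x s : S x -> x 0 \in V -> 0 <= s -> g (x s) <= g (x 0).
Proof.
move=> Sx xV s0.
have h : expR (rate n * s) * gn n (x 0) @[n --> U] --> expR (0 * s) * g (x 0).
  apply: cvgM; last exact: g_cvg.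
  apply: (continuous_cvg _ (@continuous_expR R _)).
  by apply: cvgMr_tmp; exact: cvg_invS.
rewrite mul0r expR0 mul1r in h.
apply: (ler_cvg_to (g_cvg (invV Sx xV s0)) h); apply: nearW => n.
by rewrite mulrA ler_pM2r ?invr_gt0// amplitude_flow.
Qed.

(** The normalized amplitudes of the basis vectors sum to 1 for every n, so their limits cannot all
    vanish. *)
Let g_neq0 : exists2 v, v \in V & g v != 0.
Proof.
apply: contrapT => h.
have bV (i : 'I_(\dim V)) : basis i \in V.
  by apply: vbasis_mem; apply: mem_nth; rewrite size_tuple.
have sum1 : \sum_(i < \dim V) gn n (basis i) @[n --> U] --> (1 : R).
  rewrite (_ : (fun n => _) = fun=> 1); first exact: cvg_cst.
  by apply/funext => n; rewrite /gn -mulr_suml -/(total n) divff// gt_eqF.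
have sum0 : \sum_(i < \dim V) gn n (basis i) @[n --> U] --> (0 : R).
  rewrite -[X in _ --> X](_ : \sum_(i < \dim V) (fun=> 0 : R) i = 0); last by rewrite big1.
  apply: (@cvg_big R^o 'I_(\dim V) +%R 0 xpredT (@add_continuous R^o) _ U
    (index_enum _) (fun i n => gn n (basis i)) (fun=> 0)) => i _.
  have -> : 0 = g (basis i) :> R.
    apply/eqP; rewrite eq_sym; apply: contrapT => /negP gb; apply: h.
    by exists (basis i).
  exact: g_cvg.
have e10 : (1 : R) = 0 := cvg_unique (@Rhausdorff R) sum1 sum0.
by have := oner_neq0 R; rewrite e10 eqxx.
Qed.

Let g_bound : exists2 c, 0 <= c & forall v, v \in V -> g v <= c * `|v|.
Proof.
have h (i : 'I_(\dim V)) : {c | 0 <= c & forall v, `|coord (vbasis V) i v : R^o| <= c * `|v|}.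
  by apply: cid2; exact: (@linear_bound R d R^o (coord (vbasis V) i)).
exists (\sum_i s2val (h i)); first by apply: sumr_ge0 => i _; case: (h i).
move=> v vV; apply: cvgr_to_le (g_cvg vV) _; apply: nearW => n.
rewrite (le_trans (gn_bound n vV))// mulr_suml; apply: ler_sum => i _.
by case: (h i).
Qed.


Let kernel_ex : exists K : {vspace 'cV[R]_d}, forall v, v \in K <-> v \in V /\ g v = 0.
Proof.
apply: subspace_vspace.
  split; first exact: mem0v.
  apply/eqP; rewrite eq_le g_ge0 ?mem0v// andbT.
  by have := gZ 0 (mem0v V); rewrite scale0r normr0 mul0r.
move=> a u v [uV gu] [vV gv]; split; first by rewrite memvD ?memvZ.
apply/eqP; rewrite eq_le g_ge0 ?memvD ?memvZ// andbT.
rewrite (le_trans (gD (memvZ a uV) vV))// gv addr0 (le_trans (gZ a uV))//.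
by rewrite gu mulr0.
Qed.

(* K is the kernel of the limit seminorm; the complement of K on which v - u
   lives is the kernel of projv K. *)
Lemma minimal_unstable_transversal : exists K : {vspace 'cV[R]_d},
  stable_on S K /\ exists g : 'cV[R]_d -> R, exists2 c, 0 <= c &
    [/\ forall v, v \in V -> 0 <= g v <= c * `|v|,
        forall x s, S x -> x 0 \in V -> 0 <= s -> g (x s) <= g (x 0) &
        forall v, v \in V -> exists2 u, u \in K & `|v - u| <= c * g v].
Proof.
have [K KP] := kernel_ex.
have KV : (K <= V)%VS by apply/subvP => v /KP[].
have invK : flow_invariant S K.
  move=> x Sx /KP[xV gx] t t0; apply/KP; split; first exact: invV.
  apply/eqP; rewrite eq_le -{1}gx g_flow// g_ge0//; exact: invV.
(* As g is not zero on V, its kernel K is a proper subspace, which minimality makes stable. *)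
have dimKV : (\dim K < \dim V)%N.
  rewrite ltn_neqAle dimvS// andbT; apply/negP => /eqP dimE.
  have /eqP KE : K == V by rewrite eqEdim KV dimE /=.
  have [v] := g_neq0; rewrite -KE => /KP[_ ->]; by rewrite eqxx.
exists K; split; first exact: minV.
have [c1 c10 gc1] := g_bound.
suff [c2 c20 Kc2] : exists2 c2, 0 <= c2 & forall v, v \in V ->
    `|v - projv K v| <= c2 * g v.
  exists g, (c1 + c2); first exact: addr_ge0.
  split => [v vV||v vV].
  - by rewrite g_ge0//= (le_trans (gc1 v vV))// ler_wpM2r// lerDl.
  - by move=> x s; exact: g_flow.
  - exists (projv K v); first exact: memv_proj.
    by rewrite (le_trans (Kc2 v vV))// ler_wpM2r ?g_ge0// lerDr.
(* Without such a constant, unit vectors of V in the kernel of [projv K] have g as small as desired;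
   a limit of them lies both in K and in this kernel, yet has norm 1. *)
apply: contrapT => h.
have pV v : v \in V -> v - projv K v \in V.
  by move=> vV; rewrite memvB// (subvP KV)// memv_proj.
have gp v : v \in V -> g (v - projv K v) <= g v.
  move=> vV; have pKV : - projv K v \in V by rewrite memvN (subvP KV)// memv_proj.
  rewrite (le_trans (gD vV pKV))// -scaleN1r.
  have /KP[pV' gp0] := memv_proj K v.
  have gm : g (-1 *: projv K v) = 0.
    apply/eqP; rewrite eq_le g_ge0 ?memvZ// andbT.
    by rewrite (le_trans (gZ _ pV'))// gp0 mulr0.
  by rewrite gm addr0.
have ex_w n : {w | [/\ w \in V, projv K w = 0 & `|w| = 1] & g w <= n.+1%:R^-1}.
  apply: cid2; apply: contrapT => h'; apply: h; exists n.+1%:R => // v vV.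
  rewrite leNgt; apply/negP => hv.
  have w0 : 0 < `|v - projv K v|.
    by rewrite (le_lt_trans _ hv)// mulr_ge0// g_ge0.
  apply: h'; exists (`|v - projv K v|^-1 *: (v - projv K v)).
    split; first by rewrite memvZ// pV.
      by rewrite linearZ/= linearB/= (projv_id (memv_proj K v)) subrr scaler0.
    by rewrite normrZ normfV normr_id mulVf// gt_eqF.
  rewrite (le_trans (gZ _ (pV v vV)))// normfV normr_id ler_pdivrMl//.
  rewrite ler_pdivlMr// mulrC (le_trans _ (ltW hv))// ler_wpM2l//.
  exact: gp.
have [|w ww] := mx_ultra_cvg (U := U) (u := fun n => s2val (ex_w n)) (c := 1).
  by apply: nearW => n; case: (ex_w n) => ? [_ _] /= ->.
have wV : w \in V.
  by apply: vspace_cvg ww; apply: nearW => n; case: (ex_w n) => ? [].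
have w1 : `|w| = 1.
  apply: (@cvg_unique R^o (@norm_hausdorff _ _) _ _ _ _ (cvg_norm ww)).
  rewrite (_ : (fun n => _) = fun=> 1); first exact: cvg_cst.
  by apply/funext => n; case: (ex_w n) => ? [].
have pw : projv K w = 0.
  have h1 : projv K (s2val (ex_w n)) @[n --> U] --> projv K w.
    exact: (@linear_cvg R d 'cV[R]_d (projv K)).
  apply: (cvg_unique (@norm_hausdorff _ _) h1).
  rewrite (_ : (fun n => _) = fun=> 0); first exact: cvg_cst.
  by apply/funext => n; case: (ex_w n) => ? [].
have gw : g w = 0.
  apply/eqP; rewrite eq_le g_ge0// andbT.
  have h1 : n.+1%:R^-1 + c1 * `|w - s2val (ex_w n)| @[n --> U] --> (0 + c1 * `|w - w| : R).
    apply: cvgD; first exact: cvg_invS.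
    by apply: cvgMl_tmp; apply: cvg_norm; apply: cvgB => //; exact: cvg_cst.
  rewrite subrr normr0 mulr0 addr0 in h1.
  apply: cvgr_to_ge h1 _; apply: nearW => n.
  case: (ex_w n) => wn [wnV _ _] /= gwn.
  have wwV : w - wn \in V by rewrite memvB.
  have := gD wnV wwV; rewrite addrC subrK => /le_trans; apply.
  by rewrite lerD// gc1.
have : w \in K by apply/KP.
move=> /projv_id wp; move: w1; rewrite -wp pw normr0 => /esym/eqP.
by rewrite oner_eq0.
Qed.

(** Split [x 0] into u in K and a remainder controlled by the seminorm. In time T the first part is
    divided by 4, and the second stays below a multiple of [g0 (x 0)], which trajectories do not
    increase; the recursion over multiples of T is therefore bounded. *)
Lemma minimal_unstable_bounded : exists2 B, 1 <= B &
  forall x, S x -> x 0 \in V -> forall t, 0 <= t -> `|x t| <= B * `|x 0|.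
Proof.
have [K [[C [l l0 SC]] [g0 [c c0 [gc gflow Kc]]]]] := minimal_unstable_transversal.
have e0 : 0 < 4^-1 :> R by rewrite invr_gt0.
have [T0 T0P] := expR_small `|C| l0 e0.
(* The successor makes T positive, so that t can be divided by T. *)
pose T := T0.+1.
have TP : C * expR (- (l * T%:R)) <= 4^-1.
  rewrite (le_trans (ler_wpM2r (expR_ge0 _) (ler_norm C)))// ltW//.
  rewrite (le_lt_trans _ T0P)// ler_wpM2l// ler_expR lerN2 ler_wpM2l ?(ltW l0)//.
  by rewrite ler_nat.
have [G G1 SG] := sys_bound sysS T%:R.
have G0 : 0 <= G by lra.
(* The remainder enters twice: through the norm of u, with factor 1/4, and through its own growth,
   with factor G. *)
pose c3 := (4^-1 + G) * c.
have c30 : 0 <= c3 by rewrite mulr_ge0 ?addr_ge0.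
have T0' : 0 <= T%:R :> R by [].
have step x : S x -> x 0 \in V -> `|x T%:R| <= 4^-1 * `|x 0| + c3 * g0 (x 0).
  move=> Sx xV; have [u uK xu] := Kc _ xV.
  have [|y [z [Sy Sz yu zv xyz]]] := sys_split (v := u) (w := x 0 - u) sysS Sx.
    by rewrite addrC subrK.
  rewrite xyz// (le_trans (ler_normD _ _))//.
  have h1 : `|y T%:R| <= 4^-1 * `|u|.
    have := SC y Sy _ T%:R T0'; rewrite yu => /(_ uK)/le_trans; apply.
    by rewrite ler_wpM2r.
  have h2 : `|z T%:R| <= G * `|x 0 - u|.
    by have := SG z T%:R Sz T0' (lexx _); rewrite zv.
  have h3 : `|u| <= `|x 0| + `|x 0 - u|.
    by have := ler_normB (x 0) (x 0 - u); rewrite opprB addrC subrK.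
  have h4 := ler_wpM2l (ltW e0) h3.
  have h5 : (4^-1 + G) * `|x 0 - u| <= c3 * g0 (x 0).
    by rewrite /c3 -mulrA ler_wpM2l// addr_ge0.
  rewrite (le_trans (lerD h1 h2))//; lra.
(* The bound is preserved, since a quarter of it plus [c3 * g0 (x 0)] does not exceed it. *)
have iter k : forall x, S x -> x 0 \in V ->
    `|x (k%:R * T%:R)| <= `|x 0| + 2 * c3 * g0 (x 0).
  move=> x Sx xV; elim: k => [|k ih].
    have /andP[g00 _] := gc _ xV.
    by rewrite mulr0n mul0r lerDl mulr_ge0// mulr_ge0.
  have kT0 : 0 <= k%:R * T%:R :> R by rewrite mulr_ge0.
  have := step _ (sys_shift sysS kT0 Sx); rewrite addr0 => /(_ (invV Sx xV kT0)).
  rewrite -[k.+1%:R]natr1 mulrDl mul1r => /le_trans; apply.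
  have h1 := ler_wpM2l c30 (gflow _ _ Sx xV kT0).
  have h2 := ler_wpM2l (ltW e0) ih.
  have /andP[g00 _] := gc _ xV.
  have h3 : 0 <= c3 * g0 (x 0) by rewrite mulr_ge0.
  have := normr_ge0 (x 0).
  move: h1 h2 h3; move: (`|x (k%:R * T%:R)|) (g0 (x (k%:R * T%:R))) (`|x 0|).
  move=> q1 q2 q3; rewrite -[2 * c3 * _]mulrA.
  move: (c3 * g0 (x 0)) (c3 * q2) => q4 q5; lra.
exists (G * (1 + 2 * c3 * c)).
  by rewrite mulr_ege1// lerDl mulr_ge0// mulr_ge0.
move=> x Sx xV t t0; pose k := Num.truncn (t / T%:R).
have TR : 0 < T%:R :> R by [].
have /andP[k1 k2] := truncn_itv (divr_ge0 t0 (ltW TR)).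
rewrite -/k in k1 k2.
rewrite ler_pdivlMr// in k1; rewrite ltr_pdivrMr// in k2.
have kT0 : 0 <= k%:R * T%:R :> R by rewrite mulr_ge0.
have := SG _ (t - k%:R * T%:R) (sys_shift sysS kT0 Sx).
rewrite subr_ge0 addr0 (addrC (k%:R * T%:R)) subrK => /(_ k1).
have tk : t - k%:R * T%:R <= T%:R by move: k2; rewrite -[k.+1%:R]natr1 mulrDl mul1r; lra.
move=> /(_ tk)/le_trans; apply; rewrite -mulrA ler_wpM2l//.
rewrite (le_trans (iter k x Sx xV))// !(mulrDl 1) !mul1r lerD2l -mulrA ler_wpM2l//.
  by rewrite addr_ge0.
by have /andP[] := gc _ xV.
Qed.


(** * The eigenset of points reachable at late times *)

Section invariant_set.
Variable B : R.
Hypothesis B1 : 1 <= B.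
Hypothesis SB : forall x, S x -> x 0 \in V -> forall t, 0 <= t ->
  `|x t| <= B * `|x 0|.

Let B0 : 0 < B. Proof. exact: lt_le_trans B1. Qed.

(** Unit ball in V of the norm that maps v to the supremum of the norms along all trajectories from
    v; no trajectory increases this norm. *)
Definition polar_ball : set 'cV[R]_d := [set v | v \in V /\
  forall x, S x -> x 0 = v -> forall t, 0 <= t -> `|x t| <= 1].

(** Integer times suffice: the ball is forward invariant, so the sets reached from it decrease with
    time. *)
Definition omega_set : set 'cV[R]_d := [set v | forall n : nat,
  exists x, [/\ S x, polar_ball (x 0) & x n%:R = v] ].

Let ball_small v : v \in V -> `|v| <= B^-1 -> polar_ball v.
Proof.
move=> vV vB; split => // x Sx xv t t0.
rewrite -xv in vV vB; rewrite (le_trans (SB Sx vV t0))//.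
by rewrite -ler_pdivlMl// mulr1.
Qed.

Let ball_norm v : polar_ball v -> `|v| <= 1.
Proof.
by move=> [_ h]; have [x Sx xv] := sys_exists sysS v; rewrite -xv; exact: h.
Qed.

Let ball_flow x t : S x -> polar_ball (x 0) -> 0 <= t -> polar_ball (x t).
Proof.
move=> Sx [xV h] t0; split; first exact: invV.
move=> y Sy yx s s0; have [z Sz [zx zy]] := sys_cat sysS t0 Sx Sy yx.
by rewrite -zy// (h z)// ?zx// addr_ge0.
Qed.

(** A trajectory from l is the sum of one from [u n], bounded by 1, and one from [l - u n], bounded
    by B times a norm that tends to 0. *)
Let ball_lim (u : nat -> 'cV[R]_d) (l : 'cV[R]_d) :
  (\forall n \near U, polar_ball (u n)) -> u @ U --> l -> polar_ball l.
Proof.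
move=> uP ul.
have lV : l \in V by apply: vspace_cvg ul; apply: filterS uP => n [].
split => // x Sx xl t t0.
have h : 1 + B * `|l - u n| @[n --> U] --> (1 + B * `|l - l| : R).
  apply: cvgD; first exact: cvg_cst.
  by apply: cvgMl_tmp; apply: cvg_norm; apply: cvgB => //; exact: cvg_cst.
rewrite subrr normr0 mulr0 addr0 in h.
apply: cvgr_to_ge h _; apply: filterS uP => n [unV hu].
have [|y [z [Sy Sz yu zv ->//]]] := sys_split (v := u n) (w := l - u n) sysS Sx.
  by rewrite xl addrC subrK.
rewrite (le_trans (ler_normD _ _))// lerD//; first exact: hu.
by rewrite -zv SB// zv memvB.
Qed.

(** The time m is fixed before n, which admits sequences whose n-th term is reached at time n. *)
Let lim_points (u : nat -> 'cV[R]_d) (l : 'cV[R]_d) :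
  (forall m : nat, \forall n \near U,
    exists x, [/\ S x, polar_ball (x 0) & x m%:R = u n]) ->
  u @ U --> l -> omega_set l.
Proof.
move=> h ul m.
have hx n : {x | (exists x, [/\ S x, polar_ball (x 0) & x m%:R = u n]) ->
    [/\ S x, polar_ball (x 0) & x m%:R = u n]}.
  apply: cid; have [[x hx]|nx] := pselect (exists x, [/\ S x, polar_ball (x 0) & x m%:R = u n]).
    by exists x.
  by have [x _ _] := sys_exists sysS 0; exists x.
have [||x Sx xnx] := sys_compact sysS (xn := fun n => sval (hx n)) (c := 1).
- by apply: filterS (h m) => n /(svalP (hx n)) [].
- by apply: filterS (h m) => n /(svalP (hx n)) [_ /ball_norm].
exists x; split => //.
  apply: ball_lim (xnx 0 (lexx 0)).
  by apply: filterS (h m) => n /(svalP (hx n)) [].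
apply: (cvg_unique (@norm_hausdorff _ _) (xnx m%:R (ler0n R m))).
apply: cvg_trans ul; apply: near_eq_cvg.
by apply: filterS (h m) => n /(svalP (hx n)) [_ _ ->].
Qed.

Let omega_ball v : omega_set v -> polar_ball v.
Proof. by move=> /(_ 0%N)[x [_ xP <-]]. Qed.

(** If at some time n all trajectories from the ball were smaller than eta, their doubles would be
    back in the ball, and repetition would give stability. So for every n some point of norm at
    least eta is reached at time n; a limit of such points is nonzero. *)
Let omega_nontrivial : exists2 v, omega_set v & v != 0.
Proof.
(* Half of the radius [B^-1] for which [ball_small] applies. *)
pose eta := (2 * B)^-1.
have eta0 : 0 < eta by rewrite invr_gt0 mulr_gt0.
have ex_x n : exists x, [/\ S x, polar_ball (x 0) & eta <= `|x n%:R|].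
  apply: contrapT => h; apply: unstableV; apply: (stable_onP UU Uoo sysS invV).
  have small x : S x -> polar_ball (x 0) -> `|x n%:R| < eta.
    by move=> Sx xP; rewrite ltNge; apply/negP => hx; apply: h; exists x.
  have n0 : 0 <= n%:R :> R by [].
  have double x : S x -> polar_ball (x 0) -> polar_ball (2 *: x n%:R).
    move=> Sx xP; apply: ball_small.
      by have [xV _] := xP; apply: memvZ; exact: invV.
    rewrite normrZ ger0_norm// -ler_pdivlMl// -invfM; exact/ltW/small.
  have iter k x : S x -> polar_ball (x 0) -> polar_ball (2 ^+ k *: x (k * n)%N%:R).
    elim: k x => [|k ih] x Sx xP.
      by rewrite expr0 scale1r mul0n mulr0n.
    have := double _ (sys_scale sysS (2 ^+ k) (sys_shift sysS (ler0n R (k * n)) Sx)).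
    rewrite /= addr0 => /(_ (ih x Sx xP)).
    by rewrite scalerA -exprS -natrD -mulSnr.
  move=> x Sx xV xn0.
  have x0 : 0 < `|x 0| by rewrite normr_gt0.
  (* The factor c brings [x 0] into the ball; after k doublings the norm is still at most 1, and k
     is then taken large enough for the halving. *)
  have [c c0 cE] : exists2 c : R, 0 < c & c * `|x 0| = B^-1.
    exists (B * `|x 0|)^-1; first by rewrite invr_gt0 mulr_gt0.
    by rewrite invfM divfK ?gt_eqF.
  have [k hk] : exists k : nat, 2 / c / `|x 0| < 2 ^+ k.
    have [k hk] : exists k : nat, 2 / c / `|x 0| < k%:R.
      exists (Num.bound (2 / c / `|x 0|)); apply: archi_boundP.
      by rewrite !divr_ge0// ltW.
    by exists k; rewrite (lt_trans hk)// -natrX ltr_nat ltn_expl.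
  exists (k * n)%N.
  have := iter k _ (sys_scale sysS c Sx).
  have cP : polar_ball (c *: x 0).
    apply: ball_small; first exact: memvZ.
    by rewrite normrZ ger0_norm ?(ltW c0)// cE.
  move=> /(_ cP)/ball_norm; rewrite !normrZ.
  rewrite (ger0_norm (exprn_ge0 _ _))// (ger0_norm (ltW c0)) => h1.
  have k0 : 0 < 2 ^+ k :> R by rewrite exprn_gt0.
  have : 2 / c < 2 ^+ k * `|x 0| by rewrite -ltr_pdivrMr.
  rewrite ltr_pdivrMr// => h2.
  rewrite -(ltr_pM2l c0) -(ltr_pM2l k0) (le_lt_trans h1)//.
  have -> : 2 ^+ k * (c * (`|x 0| / 2)) = 2 ^+ k * `|x 0| * c / 2 by ring.
  by rewrite ltr_pdivlMr// mul1r.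
pose x n := sval (cid (ex_x n)).
have Sx n : S (x n) by rewrite /x; case: cid => ? [].
have xP n : polar_ball (x n 0) by rewrite /x; case: cid => ? [].
have xe n : eta <= `|x n n%:R| by rewrite /x; case: cid => ? [].
have [|v xv] := mx_ultra_cvg (U := U) (u := fun n => x n n%:R) (c := 1).
  by apply: nearW => n; apply/ball_norm/ball_flow.
exists v.
  apply: lim_points xv => m; apply: Uoo; near=> n.
  have mn : (m <= n)%N by near: n; exact: nbhs_infty_ge.
  have nm0 : 0 <= (n - m)%N%:R :> R by [].
  (* The last m units of time of [x n] form a trajectory that starts in the ball. *)
  exists (fun t => x n ((n - m)%N%:R + t)); split.
  - exact: (sys_shift sysS nm0 (Sx n)).
  - by rewrite addr0; exact: ball_flow.
  - by rewrite -natrD subnK.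
rewrite -normr_gt0 (lt_le_trans eta0)//.
by apply: cvgr_to_ge (cvg_norm xv) _; apply: nearW => n.
Unshelve. all: by end_near. Qed.

Lemma omega_set_eigenset : sys_eigenset S omega_set 0.
Proof.
have [v Mv vn0] := omega_nontrivial.
split.
- apply: (@bounded_seq_closed_compact R d U UU Uoo _ 1) => [w /omega_ball/ball_norm//|].
  move=> u l Mu; apply: lim_points => m; apply: nearW => n; exact: Mu.
- by exists v.
- by move=> M0; move: Mv; rewrite M0 /= => v0; rewrite v0 eqxx in vn0.
move=> t t0; rewrite mul0r expR0; apply/seteqP; split.
  move=> _ [x [Sx Mx] <-]; exists (x t); last by rewrite scale1r.
  (* Prolonging by x a trajectory that reaches [x 0] at time n, then skipping its first t units of
     time, gives one that reaches [x t] at time n. *)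
  move=> n; have [y [Sy yP yx]] := Mx n.
  have [z Sz [zy zx]] := sys_cat sysS (ler0n R n) Sy Sx (esym yx).
  exists (fun s => z (t + s)); split; first exact: (sys_shift sysS t0 Sz).
    rewrite addr0; apply: ball_flow => //; rewrite zy//.
  by rewrite addrC zx.
move=> _ [w Mw <-]; rewrite scale1r.
(* Conversely, w is reached from the ball at every time n. Followed from time [n - t] on, these
   trajectories have a limit that starts in [omega_set] and passes through w at time t; only n >= t
   matters along U. *)
pose x n := sval (cid (Mw n)).
have Sx n : S (x n) by rewrite /x; case: cid => ? [].
have xP n : polar_ball (x n 0) by rewrite /x; case: cid => ? [].
have xw n : x n n%:R = w by rewrite /x; case: cid => ? [].
pose k n : R := n%:R - t.
pose y n s := x n (k n + s).
have tn : \forall n \near U, t <= n%:R.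
  by apply: Uoo; near=> n; near: n; exact: nbhs_infty_ger.
have [||z Sz yz] := sys_compact sysS (xn := y) (c := 1).
- apply: filterS tn => n tn; apply: (sys_shift sysS) => //.
  by rewrite subr_ge0.
- apply: filterS tn => n tn; rewrite /y addr0.
  by apply/ball_norm/ball_flow; rewrite // subr_ge0.
exists z; last first.
  apply: (cvg_unique (@norm_hausdorff _ _) (yz t t0)).
  rewrite (_ : (fun n => y n t) = fun=> w); first exact: cvg_cst.
  by apply/funext => n; rewrite /y /k subrK xw.
split => //; apply: lim_points (yz 0 (lexx 0)) => m.
apply: Uoo; near=> n.
have tmn : t + m%:R <= n%:R by near: n; exact: nbhs_infty_ger.
have h0 : 0 <= n%:R - t - m%:R by lra.
exists (fun s => x n (n%:R - t - m%:R + s)); split.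
- exact: (sys_shift sysS h0 (Sx n)).
- by rewrite addr0; exact: ball_flow.
- by rewrite /y /k addr0 subrK.
Unshelve. all: by end_near. Qed.

End invariant_set.
End minimal_space.

Lemma zero_eigenset : ~ stable_on S fullv -> exists M, sys_eigenset S M 0.
Proof.
move=> /minimal_unstable[V [invV nsV minV]].
have [B B1 SB] := minimal_unstable_bounded invV nsV minV.
by exists (omega_set V); exact: omega_set_eigenset SB.
Qed.

End eigenset_existence.

(** * Switching systems are linear systems *)

Section law_solution_system.
Context {R : realType} {d : nat}.
Variables (U : set_system nat) (UU : UltraFilter U) (Uoo : \oo `<=` U).
Variables (A : set 'M[R]_d) (L : R) (B0 : 'M[R]_d).
Hypotheses (A0 : A B0) (Acomp : compact A).
Hypothesis Aconv : forall p q l, A p -> A q -> 0 <= l <= 1 ->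
  A (l *: p + (1 - l) *: q).
Hypothesis AL : forall B, A B -> `|B| <= L.
Hypothesis AmL : forall B (v : 'cV[R]_d), A B -> `|B *m v| <= L * `|v|.

Let L0 : 0 <= L. Proof. exact: le_trans (normr_ge0 _) (AL A0). Qed.

Lemma law_solution_shift x s : 0 <= s -> law_solution A L x ->
  law_solution A L (fun t => x (s + t)).
Proof.
move=> s0 [F [F0 lawF solx]]; exists (fun t => F (s + t) - F s); split.
- by rewrite addr0 subrr.
- move=> T u v u0 uv vT.
  have [] := lawF (s + v) (s + u) (s + v) => //; first exact: addr_ge0.
    by rewrite lerD2l.
  move=> B AB E; exists B => //.
  by rewrite opprB addrA subrK E; congr (_ *: _); ring.
- move=> T u v u0 uv vT; rewrite opprB addrA subrK.
  have := solx (s + v) (s + u) (s + v) (addr_ge0 s0 u0).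
  by rewrite lerD2l => /(_ uv (lexx _)); rewrite opprD addrACA subrr add0r.
Qed.

Lemma law_solution_cat x y s : 0 <= s -> law_solution A L x ->
  law_solution A L y -> y 0 = x s -> exists2 z, law_solution A L z &
    (forall t, 0 <= t -> t <= s -> z t = x t) /\
    (forall t, 0 <= t -> z (s + t) = y t).
Proof.
move=> s0 [F [F0 lawF solx]] [G [G0 lawG soly]] yx.
pose z t := if t <= s then x t else y (t - s).
pose H t := if t <= s then F t else F s + G (t - s).
have zl t : t <= s -> z t = x t by rewrite /z => ->.
have zr t : s <= t -> z t = y (t - s).
  by move=> st; rewrite /z; case: leP => // ts; rewrite (_ : t = s) ?subrr//; lra.
have Hl t : t <= s -> H t = F t by rewrite /H => ->.
have Hr t : s <= t -> H t = F s + G (t - s).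
  move=> st; rewrite /H; case: leP => // ts.
  by rewrite (_ : t = s) ?subrr ?G0 ?addr0//; lra.
exists z; last first.
  split => t t0 => [ts|]; first exact: zl.
  by rewrite zr ?lerDl// addrC addKr.
exists H; split; first by rewrite Hl.
- move=> T u v u0 uv vT; have [vs|sv] := leP v s.
    rewrite (Hl v vs) (Hl u (le_trans uv vs)).
    exact: (lawF T).
  have [us|su] := leP u s; last first.
    rewrite (Hr v (ltW sv)) (Hr u (ltW su)).
    have [] := lawG (v - s) (u - s) (v - s) => //.
    + by rewrite subr_ge0 ltW.
    + by rewrite lerD2r.
    + move=> B AB E; exists B => //; rewrite opprD addrACA subrr add0r E.
      by congr (_ *: _); ring.
  have [B AB BE] := lawF s u s u0 us (lexx s).
  have vs0 : 0 <= v - s by rewrite subr_ge0 ltW.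
  have [B' AB' BE'] := lawG (v - s) 0 (v - s) (lexx 0) vs0 (lexx _).
  rewrite G0 !subr0 in BE'.
  have us0 : 0 <= s - u by rewrite subr_ge0.
  (* Across s, the slope is the average of the slopes on the two sides, weighted by lengths. *)
  have [C AC CE] := convex_comb Aconv AB AB' us0 vs0.
  exists C => //; rewrite (Hr v (ltW sv)) (Hl u us) addrAC BE BE' CE.
  by congr (_ *: _); ring.
- move=> T u v u0 uv vT; have [vs|sv] := leP v s.
    rewrite (Hl v vs) (Hl u (le_trans uv vs)) (zl v vs) (zl u (le_trans uv vs)).
    exact: (solx T).
  have vs0 : 0 <= v - s by rewrite subr_ge0 ltW.
  have [us|su] := leP u s; last first.
    rewrite (Hr v (ltW sv)) (Hr u (ltW su)) (zr v (ltW sv)) (zr u (ltW su)).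
    have := soly (v - s) (u - s) (v - s); rewrite subr_ge0 lerD2r lexx.
    move=> /(_ (ltW su) uv isT); rewrite (opprD (F s)) [F s + _ + _]addrACA subrr add0r.
    by rewrite opprB addrA subrK.
  have us0 : 0 <= s - u by rewrite subr_ge0.
  rewrite (Hr v (ltW sv)) (Hl u us) (zr v (ltW sv)) (zl u us).
  have h1 := solx s u s u0 us (lexx s).
  have h2 := soly (v - s) 0 (v - s) (lexx 0) vs0 (lexx _).
  rewrite G0 !subr0 yx in h2.
  have h3 := sol_sub_le AmL (@lawF s) (@solx s) u0 us (lexx s).
  have h4 := sol_le AmL (@lawF s) (@solx s) u0 us (lexx s).
  have h5 := law_mulmx_le AmL (@lawG (v - s)) (x s - x u) (lexx 0) vs0 (lexx _).
  rewrite G0 !subr0 in h5.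
  have -> : y (v - s) - x u - (F s + G (v - s) - F u) *m x u =
      (y (v - s) - x s - G (v - s) *m x s) +
      (x s - x u - (F s - F u) *m x u) + G (v - s) *m (x s - x u).
    rewrite (addrAC (F s)) mulmxDl mulmxBr.
    by apply/colP => i; rewrite !mxE; ring.
  rewrite (le_trans (ler_normD _ _))//.
  rewrite (le_trans (lerD (ler_normD _ _) (lexx _)))//.
  rewrite (le_trans (lerD (lerD h2 h1) h5))//.
  have Lvs : 0 <= L * (v - s) by rewrite mulr_ge0.
  have h6 := ler_wpM2l (growth_ge0 L (v - s)) h4.
  have h7 := ler_wpM2l Lvs h3.
  (* This exact identity makes the errors before s, after s and at the junction fit into a single
     [growth] bound. *)
  have -> : growth L (v - u) = growth L (v - s) * expR (L * (s - u)) +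
      growth L (s - u) + L * (v - s) * (expR (L * (s - u)) - 1).
    rewrite /growth (_ : L * (v - u) = L * (v - s) + L * (s - u)); last by ring.
    by rewrite expRD; ring.
  move: h6 h7; rewrite !mulrDl -!mulrA; lra.
Qed.

Lemma law_solution_scale x (c : R) : law_solution A L x ->
  law_solution A L (fun t => c *: x t).
Proof.
move=> [F [F0 lawF solx]]; exists F; split => // T s t s0 st tT.
rewrite -scalemxAr -!scalerBr !normrZ mulrCA ler_wpM2l//.
exact: solx tT.
Qed.

(** Both parts obey the law of x: y solves it from v, and [x - y] is again a solution by
    [sol_onB]. *)
Lemma law_solution_split x v w : law_solution A L x -> x 0 = v + w ->
  exists y z, [/\ law_solution A L y, law_solution A L z, y 0 = v, z 0 = w &
    forall t, 0 <= t -> x t = y t + z t].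
Proof.
move=> [F [F0 lawF solx]] xvw.
have [y yv soly] := sol_exists A0 Aconv AL AmL UU Uoo v lawF.
exists y, (x - y); split.
- by exists F.
- exists F; split => // T.
  exact: (sol_onB A0 Aconv AL AmL (@lawF T) (@solx T) (@soly T)).
- by [].
- by rewrite !fctE xvw yv addrC addKr.
- by move=> t t0; rewrite !fctE [RHS]addrC subrK.
Qed.

Lemma law_solution_exists v : exists2 x, law_solution A L x & x 0 = v.
Proof.
have lawF T : law_on A T (fun t => t *: B0).
  by move=> s t _ _ _; exists B0 => //; rewrite -scalerBl.
have [y yv soly] := sol_exists A0 Aconv AL AmL UU Uoo v lawF.
by exists y => //; exists (fun t => t *: B0); split => //; rewrite scale0r.
Qed.

Lemma law_solution_le x s t : law_solution A L x -> 0 <= s -> s <= t ->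
  `|x t| <= expR (L * (t - s)) * `|x s|.
Proof.
by move=> [F [F0 lawF solx]] s0 st; exact: (sol_le AmL (@lawF t) (@solx t)).
Qed.

Lemma law_solution_sub_le x s t : law_solution A L x -> 0 <= s -> s <= t ->
  `|x t - x s| <= (expR (L * (t - s)) - 1) * `|x s|.
Proof.
by move=> [F [F0 lawF solx]] s0 st; exact: (sol_sub_le AmL (@lawF t) (@solx t)).
Qed.

Lemma law_solution_compact (xn : nat -> R -> 'cV[R]_d) c :
  (\forall n \near U, law_solution A L (xn n)) -> (\forall n \near U, `|xn n 0| <= c) ->
  exists2 x, law_solution A L x & forall t, 0 <= t -> xn n t @[n --> U] --> x t.
Proof.
move=> Sxn xnc.
have hF n : {F | F 0 = 0 /\ (law_solution A L (xn n) ->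
    forall T, law_on A T F /\ sol_on L T F (xn n))}.
  apply: cid; have [[F [F0 lawF solF]]|nS] := pselect (law_solution A L (xn n)).
    by exists F; split.
  by exists (fun=> 0).
have [||T|F [x [F0 lawF solx] xnx]] := law_sol_compact B0 Acomp AL AmL UU
  (Fn := fun n => sval (hF n)) (xn := xn) (c := c).
- by move=> n; have [] := svalP (hF n).
- exact: xnc.
- by apply: filterS Sxn => n Sn; have [_ /(_ Sn T)] := svalP (hF n).
by exists x => //; exists F.
Qed.

Lemma law_solution_system : linear_system U (law_solution A L).
Proof.
split.
- by move=> x s s0; exact: law_solution_shift.
- by move=> x y s; exact: law_solution_cat.
- by move=> x c; exact: law_solution_scale.
- by move=> x v w; exact: law_solution_split.
- exact: law_solution_exists.
- move=> T; exists (expR (L * `|T|)); first by rewrite expR_ge1// mulr_ge0.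
  move=> x t Sx t0 tT; rewrite (le_trans (law_solution_le Sx (lexx 0) t0))//.
  by rewrite subr0 ler_wpM2r// ler_expR ler_wpM2l// (le_trans tT)// ler_norm.
- exact: law_solution_compact.
Qed.

Lemma trajectoryE : trajectory A = law_solution A L.
Proof.
apply/funext => x; apply/propext; split.
  exact: (trajectory_law_solution A0 Acomp Aconv AL AmL).
move=> [F [F0 lawF solx]]; exact: (law_solution_trajectory A0 Acomp AL AmL lawF solx).
Qed.

End law_solution_system.

(** * The Lyapunov exponent and the eigenvalues *)

Section lyapunov.
Context {R : realType} {d : nat}.
Variables (U : set_system nat) (UU : UltraFilter U) (Uoo : \oo `<=` U).
Variable S : set (R -> 'cV[R]_d).
Hypothesis sysS : linear_system U S.

Let rates : set R := [set b | forall x, S x -> rate_le b x].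
Hypothesis rates_inf : has_inf rates.
Let sigma := inf rates.

(** Rescaling by sigma brings the infimum of the rates to 0. The rescaled system is not stable on
    the whole space, since a decay rate l would make [sigma - l] a rate of S; so [zero_eigenset]
    applies. *)
Lemma inf_rate_eigenvalue : exists M, sys_eigenset S M sigma.
Proof.
have [M [Mc M0 Mn0 Mt]] : exists M, sys_eigenset (rescale sigma S) M 0.
  have sysr := rescale_system UU sigma sysS.
  have := zero_eigenset UU Uoo sysr; apply => [b x b0 Sx|].
    have [c Sc cb] := inf_adherent b0 rates_inf.
    have [C xC] := Sc _ Sx; exists `|C| => t t0; have := xC t t0.
    rewrite normrZ (ger0_norm (expR_ge0 _)) -ler_pdivlMl ?expR_gt0//.
    move=> /le_trans; apply; rewrite -expRN mulrCA -expRD.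
    rewrite (le_trans (ler_wpM2r (expR_ge0 _) (ler_norm C)))// ler_wpM2l//.
    rewrite ler_expR addrC -mulrBl ler_wpM2r// lerBlDl; exact: ltW.
  move=> [C [l l0 SC]].
  have : sigma <= sigma - l; last by rewrite lerBrDl gerDr leNgt l0.
  apply: ge_inf; first by have [] := rates_inf.
  move=> x Sx; exists (C * `|x 0|) => t t0.
  have := SC _ (rescaleP sigma Sx) (memvf _) t t0.
  rewrite mulr0 oppr0 expR0 scale1r normrZ (ger0_norm (expR_ge0 _)) expRN.
  rewrite -ler_pdivlMl ?invr_gt0 ?expR_gt0// invrK => /le_trans; apply.
  by rewrite mulrBl expRD le_eqVlt; apply/orP; left; apply/eqP; ring.
exists M; split => // t t0; have {}Mt := Mt t t0.
rewrite mul0r expR0 in Mt; apply/seteqP; split.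
- move=> _ [x [Sx Mx] <-].
  have [v Mv vE] : [set 1 *: v | v in M] (expR (- (sigma * t)) *: x t).
    rewrite -Mt; exists (fun t => expR (- (sigma * t)) *: x t) => //.
    by split; [exact: rescaleP|rewrite mulr0 oppr0 expR0 scale1r].
  by exists v => //; rewrite -[v]scale1r vE expR_scaleK.
- move=> _ [v Mv <-].
  have [x [Sx Mx] xv] : [set x t | x in [set x | rescale sigma S x /\ M (x 0)]] v.
    by rewrite Mt; exists v; rewrite ?scale1r.
  exists (fun t => expR (sigma * t) *: x t); last by rewrite xv.
  by split; [exact: Sx|rewrite mulr0 expR0 scale1r].
Qed.

Lemma eigenvalue_le_inf_rate M alpha : sys_eigenset S M alpha -> alpha <= sigma.
Proof.
move=> eM; apply: lb_le_inf; first by have [] := rates_inf.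
move=> b Sb; apply: (eigenvalue_le_rate UU Uoo sysS eM (@flow_invariantT _ _ S)).
  by move=> v _; exact: memvf.
by move=> x Sx _; exact: Sb.
Qed.

(** The dimensions are at least 1 and, for eigenvalues other than sigma, smaller than that of sigma,
    itself at most d; their predecessors thus inject these eigenvalues into the integers below
    [d.-1]. *)
Lemma eigenvalues_card : 
  [set alpha | (exists M, sys_eigenset S M alpha) /\ alpha <> sigma] #<= `I_(d.-1).
Proof.
have [D [Dd Dlt]] := eigenvalues_dim UU Uoo sysS.
have [M0 eM0] := inf_rate_eigenvalue.
set X := [set alpha | _].
have inj : {in X &, injective (fun alpha => (D alpha).-1)}.
  move=> a b; rewrite !inE => -[[M eM] _] [[N eN] _] Dab.
  have /andP[a0 _] := Dd _ _ eM; have /andP[b0 _] := Dd _ _ eN.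
  have {}Dab : D a = D b by rewrite -(prednK a0) -(prednK b0) Dab.
  case: (ltgtP a b) => // ab.
  - by have := Dlt _ _ _ _ eM eN ab; rewrite Dab ltnn.
  - by have := Dlt _ _ _ _ eN eM ab; rewrite Dab ltnn.
rewrite -(card_le_eql (inj_card_eq inj)); apply: subset_card_le.
move=> _ [a [[M eM] asigma] <-] /=.
have /andP[a0 _] := Dd _ _ eM; have /andP[s0 sd] := Dd _ _ eM0.
have lt_as : a < sigma.
  by rewrite lt_neqAle (eigenvalue_le_inf_rate eM) andbT; apply/eqP.
have Das := Dlt _ _ _ _ eM eM0 lt_as.
by rewrite -ltnS (prednK a0) (leq_trans Das)// (leq_trans sd)// leqSpred.
Qed.

End lyapunov.

Theorem theorem2 (R : realType) (d : nat) (A : set 'M[R]_d)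
    (A_nonempty : A !=set0) (A_compact : compact A)
    (A_convex : convex_set (A : set (convex_lmodType 'M[R]_d)))
    (A_no0 : ~ A 0) :
  [/\ is_eigenvalue A (lyapunov_exponent A),
      [set alpha | is_eigenvalue A alpha /\ alpha <> lyapunov_exponent A]
        #<= `I_(d.-1) &
      forall alpha, is_eigenvalue A alpha -> alpha <> lyapunov_exponent A ->
        alpha < lyapunov_exponent A].
Proof.
have [B0 AB0] := A_nonempty.
have Aconv p q l : A p -> A q -> 0 <= l <= 1 -> A (l *: p + (1 - l) *: q).
  move=> Ap Aq /andP[l0 l1].
  by have := A_convex p q (Itv01 l0 l1) (mem_set Ap) (mem_set Aq); rewrite inE.
have [r r0 Ar] : exists2 r, 0 <= r & forall B, A B -> `|B| <= r.
  have [r [_ Ar]] := compact_bounded A_compact; exists (`|r| + 1); first exact: addr_ge0.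
  by move=> B AB; apply: Ar => //; rewrite (le_lt_trans (ler_norm r))// ltrDl.
(* L bounds both the sup norm of the entries and the operator norm, which may be d times larger; the
   final 1 makes it positive. *)
pose L := (d%:R + 1) * r + 1.
have dr0 : 0 <= d%:R * r by rewrite mulr_ge0.
have AL B : A B -> `|B| <= L by move=> /Ar Br; rewrite /L; lra.
have AmL B (v : 'cV[R]_d) : A B -> `|B *m v| <= L * `|v|.
  move=> AB; rewrite (le_trans (mx_normM B v))// ler_wpM2r//.
  by have := ler_wpM2l (ler0n R d) (Ar _ AB); rewrite /L; lra.
have L0 : 0 < L by rewrite /L; lra.
(* For d = 0 the only matrix is 0, which A does not contain. In positive dimension there are nonzero
   trajectories, which bound the rates from below. *)
have d0 : (0 < d)%N.
  rewrite lt0n; apply/eqP => d0; apply: A_no0.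
  suff -> : 0 = B0 by [].
  by apply/matrixP => i; have := ltn_ord i; rewrite {2}d0.
have [U UU Uoo] := eventually_ultra.
have trE := trajectoryE AB0 A_compact Aconv AL AmL.
have sysA : linear_system U (trajectory A).
  by rewrite trE; exact: (law_solution_system UU Uoo AB0 A_compact Aconv AL AmL).
have infA : has_inf [set b | forall x, trajectory A x -> rate_le b x].
  split.
    exists L => x; rewrite trE => Sx; exists `|x 0| => t t0.
    by have := law_solution_le AmL Sx (lexx 0) t0; rewrite subr0 mulrC.
  (* As [expR (L * tau)] is 3/2, a trajectory moves by at most half of its norm in time tau, hence
     loses at most a factor 2; no rate lies below [- ln 2 / tau]. *)
  pose tau := ln (3 / 2) / L.
  have tau0 : 0 < tau by rewrite divr_gt0// ln_gt0//; lra.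
  have Ltau : expR (L * tau) = 3 / 2.
    by rewrite /tau mulrC divfK ?gt_eqF// lnK// posrE; lra.
  exists (- ln 2 / tau) => b Sb; rewrite leNgt; apply/negP => bt.
  have [x Sx x1] := sys_exists sysA (const_mx 1).
  have xn0 : 0 < `|x 0|.
    rewrite normr_gt0 x1; apply/eqP => /matrixP/(_ (Ordinal d0) 0).
    by rewrite !mxE; apply/eqP; rewrite oner_eq0.
  have half s : 0 <= s -> `|x s| <= 2 * `|x (s + tau)|.
    move=> s0; rewrite trE in Sx.
    have st : s <= s + tau by rewrite lerDl ltW.
    have := law_solution_sub_le AmL Sx s0 st; rewrite (addrC s) addrK Ltau.
    have := ler_normD (x s - x (tau + s)) (x (tau + s)); rewrite subrK distrC; lra.
  have lower k : `|x 0| <= 2 ^+ k * `|x (k%:R * tau)|.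
    elim: k => [|k ih]; first by rewrite mulr0n mul0r expr0 mul1r.
    rewrite (le_trans ih)// -[k.+1%:R]natr1 (mulrDl k%:R) mul1r exprSr -mulrA.
    by rewrite ler_wpM2l ?exprn_ge0// half// mulr_ge0// ltW.
  have [C xC] := Sb _ Sx.
  pose l := - ln 2 - b * tau.
  have l0 : 0 < l by rewrite subr_gt0; move: bt; rewrite ltr_pdivlMr.
  have [k] := expR_small C l0 xn0; rewrite ltNge => /negP; apply.
  rewrite (le_trans (lower k))//.
  have kt0 : 0 <= k%:R * tau by rewrite mulr_ge0// ltW.
  rewrite (le_trans (ler_wpM2l _ (xC _ kt0))) ?exprn_ge0//.
  have -> : - (l * k%:R) = ln 2 * k%:R + b * (k%:R * tau) by rewrite /l; ring.
  rewrite expRD expRM_natr lnK ?posrE//.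
  by rewrite le_eqVlt; apply/orP; left; apply/eqP; ring.
have sE : lyapunov_exponent A = inf [set b | forall x, trajectory A x -> rate_le b x].
  by [].
split.
- exact: (inf_rate_eigenvalue UU Uoo sysA infA).
- exact: (eigenvalues_card UU Uoo sysA infA).
- move=> alpha [M eM] /eqP an; rewrite lt_neqAle an.
  exact: (eigenvalue_le_inf_rate UU Uoo sysA infA eM).
Qed.
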